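(* If $M$ is a term of $\ell\Lambda_\infty^{4S}$, $M\Rightarrow N$ and $M\Rightarrow L$, then there is a term $P$ of $\ell\Lambda_\infty^{4S}$ such that $N\Rightarrow P$ and $L\Rightarrow P$.
   Context: Preterms: possibly infinite trees generated by $M ::= x \mid MN \mid \lambda x.M \mid \lambda^{\downarrow}x.M \mid \lambda^{\uparrow}x.M \mid \downarrow M \mid \uparrow M$ ($\downarrow M$ inductive box, $\uparrow M$ coinductive box); substitution is capture-avoiding. Patterns: $x,\downarrow x,\uparrow x,\#x,\dagger x$; environments: finite sets of patterns, each variable in at most one; $\Theta,\Xi,\Psi,\Phi$ linear environments with marked versions $\#\Theta$ etc.; $\Upsilon,\Pi$ environments with only patterns $y$, $\downarrow y$; commas are disjoint unions. A term of $\ell\Lambda_\infty^{4S}$ is a preterm $M$ with $\Gamma\vdash M$ derivable for some $\Gamma$ by: (vl) $\#\Theta,\uparrow\Xi,\dagger\Psi,x\vdash x$; (vd) $\#\Theta,\uparrow\Xi,\dagger\Psi,\#x\vdash x$; (va) $\#\Theta,\uparrow\Xi,\dagger\Psi,\dagger x\vdash x$; (a) from $\Upsilon,\#\Theta,\uparrow\Xi,\dagger\Psi\vdash M$ and $\Pi,\#\Theta,\uparrow\Xi,\dagger\Psi\vdash N$ infer $\Upsilon,\Pi,\#\Theta,\uparrow\Xi,\dagger\Psi\vdash MN$; (ll) $\Gamma,x\vdash M$ gives $\Gamma\vdash\lambda x.M$; (li)$_1$ $\Gamma,\#x\vdash M$ gives $\Gamma\vdash\lambda^\downarrow x.M$;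 (li)$_2$ $\Gamma,\downarrow x\vdash M$ gives $\Gamma\vdash\lambda^\downarrow x.M$; (lc) $\Gamma,\uparrow x\vdash M$ gives $\Gamma\vdash\lambda^\uparrow x.M$; (mi) from $\Xi,\uparrow\Psi,\dagger\Phi\vdash M$ infer $\#\Theta,\downarrow\Xi,\uparrow\Psi,\dagger\Phi\vdash\downarrow M$; (mc) from $\dagger\Xi,\dagger\Psi\vdash M$ infer $\#\Theta,\uparrow\Xi,\dagger\Psi\vdash\uparrow M$; (mc) coinductive, others inductive (every infinite branch of a derivation contains infinitely many (mc)). Basic reduction: $(\lambda x.M)N\mapsto M[N/x]$, $(\lambda^\downarrow x.M)(\downarrow N)\mapsto M[N/x]$, $(\lambda^\uparrow x.M)(\uparrow N)\mapsto M[N/x]$; $M\to N$ iff $M=C[L]$, $N=C[P]$, $L\mapsto P$ for a one-hole context $C$. Infinitary reduction $\Rightarrow$ and auxiliary $\leadsto$ are given by the mixed formal system: (coinductive rule) if $M\to^*N$ and $N\leadsto L$ then $M\Rightarrow L$; (inductive rules) $x\leadsto x$; if $M\leadsto N$ and $L\leadsto P$ then $ML\leadsto NP$; if $M\leadsto N$ then $\lambda x.M\leadsto\lambda x.N$, $\lambda^\downarrow x.M\leadsto\lambda^\downarrow x.N$, $\lambda^\uparrow x.M\leadsto\lambda^\uparrow x.N$ and $\downarrow M\leadsto\downarrow N$; if $M\Rightarrow N$ then $\uparrow M\leadsto\uparrow N$. A judgment holds iff it is the root of a possibly infinite derivation tree in which every infinite branch uses the coinductive rule infinitely often. *)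

(* Defs.v *)
From Stdlib Require Import Arith.

(** Preterms: possibly infinite trees, with de Bruijn indices
    (so that capture-avoiding substitution is well defined; terms are
    alpha-equivalence classes). *)
CoInductive pterm : Type :=
| Var  : nat -> pterm
| App  : pterm -> pterm -> pterm
| Lam  : pterm -> pterm
| LamI : pterm -> pterm
| LamC : pterm -> pterm
| BoxI : pterm -> pterm
| BoxC : pterm -> pterm.

CoInductive bisim : pterm -> pterm -> Prop :=
| bs_var n : bisim (Var n) (Var n)
| bs_app a b a' b' : bisim a a' -> bisim b b' -> bisim (App a b) (App a' b')
| bs_lam a a' : bisim a a' -> bisim (Lam a) (Lam a')
| bs_lamI a a' : bisim a a' -> bisim (LamI a) (LamI a')
| bs_lamC a a' : bisim a a' -> bisim (LamC a) (LamC a')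
| bs_boxI a a' : bisim a a' -> bisim (BoxI a) (BoxI a')
| bs_boxC a a' : bisim a a' -> bisim (BoxC a) (BoxC a').

CoFixpoint lift (d c : nat) (t : pterm) : pterm :=
  match t with
  | Var n => Var (if n <? c then n else n + d)
  | App a b => App (lift d c a) (lift d c b)
  | Lam a => Lam (lift d (S c) a)
  | LamI a => LamI (lift d (S c) a)
  | LamC a => LamC (lift d (S c) a)
  | BoxI a => BoxI (lift d c a)
  | BoxC a => BoxC (lift d c a)
  end.

CoFixpoint subst (k : nat) (N : pterm) (t : pterm) : pterm :=
  match t with
  | Var n => if n <? k then Var n
             else if n =? k then lift k 0 N
             else Var (n - 1)
  | App a b => App (subst k N a) (subst k N b)
  | Lam a => Lam (subst (S k) N a)
  | LamI a => LamI (subst (S k) N a)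
  | LamC a => LamC (subst (S k) N a)
  | BoxI a => BoxI (subst k N a)
  | BoxC a => BoxC (subst k N a)
  end.

Inductive basic : pterm -> pterm -> Prop :=
| b_beta M N P : bisim P (subst 0 N M) -> basic (App (Lam M) N) P
| b_betaI M N P : bisim P (subst 0 N M) -> basic (App (LamI M) (BoxI N)) P
| b_betaC M N P : bisim P (subst 0 N M) -> basic (App (LamC M) (BoxC N)) P.

Inductive step : pterm -> pterm -> Prop :=
| s_base M N : basic M N -> step M N
| s_appl M M' N : step M M' -> step (App M N) (App M' N)
| s_appr M N N' : step N N' -> step (App M N) (App M N')
| s_lam M M' : step M M' -> step (Lam M) (Lam M')
| s_lamI M M' : step M M' -> step (LamI M) (LamI M')
| s_lamC M M' : step M M' -> step (LamC M) (LamC M')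
| s_boxI M M' : step M M' -> step (BoxI M) (BoxI M')
| s_boxC M M' : step M M' -> step (BoxC M) (BoxC M').

Inductive steps : pterm -> pterm -> Prop :=
| st_refl M : steps M M
| st_step M N L : step M N -> steps N L -> steps M L.

(** Inductive rules of the auxiliary relation ~>, parametrised by the
    relation R used for the (coinductive) premise M => N of the up-box rule. *)
Inductive leadsto (R : pterm -> pterm -> Prop) : pterm -> pterm -> Prop :=
| l_var x : leadsto R (Var x) (Var x)
| l_app M N L P : leadsto R M N -> leadsto R L P -> leadsto R (App M L) (App N P)
| l_lam M N : leadsto R M N -> leadsto R (Lam M) (Lam N)
| l_lamI M N : leadsto R M N -> leadsto R (LamI M) (LamI N)
| l_lamC M N : leadsto R M N -> leadsto R (LamC M) (LamC N)
| l_boxI M N : leadsto R M N -> leadsto R (BoxI M) (BoxI N)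
| l_boxC M N : R M N -> leadsto R (BoxC M) (BoxC N).

(** Infinitary reduction M => L: greatest fixed point of
    R |-> { (M,L) | exists N, M ->* N /\ N ~>_R L }, i.e. derivations in
    which every infinite branch uses the coinductive rule infinitely often. *)
Definition infred (M L : pterm) : Prop :=
  exists R : pterm -> pterm -> Prop,
    (forall a b, R a b -> exists c, steps a c /\ leadsto R c b) /\ R M L.

(** Patterns: x, down x, up x, #x, dagger x. *)
Inductive pk : Type := PLin | PInd | PCoind | PHash | PDag.

Definition env := nat -> option pk.

Definition finite_env (G : env) : Prop :=
  exists n, forall i, n <= i -> G i = None.

Definition ext (p : pk) (G : env) : env :=
  fun i => match i with 0 => Some p | S j => G j end.

(** entries allowed in #Theta, up Xi, dagger Psi *)
Definition shared_ok (o : option pk) : Prop :=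
  match o with
  | None | Some PHash | Some PCoind | Some PDag => True
  | _ => False
  end.

(** G = Upsilon,Pi,#Theta,upXi,daggerPsi with
    G1 = Upsilon,#Theta,upXi,daggerPsi and G2 = Pi,#Theta,upXi,daggerPsi. *)
Definition app_split (G G1 G2 : env) : Prop :=
  forall i, match G i with
            | None => G1 i = None /\ G2 i = None
            | Some PLin | Some PInd =>
                (G1 i = G i /\ G2 i = None) \/ (G1 i = None /\ G2 i = G i)
            | Some _ => G1 i = G i /\ G2 i = G i
            end.

(** (mi): conclusion #Theta,downXi,upPsi,daggerPhi ; premise Xi,upPsi,daggerPhi *)
Definition boxI_ok (G : env) : Prop := forall i, G i <> Some PLin.
Definition boxI_env (G : env) : env :=
  fun i => match G i with
           | Some PInd => Some PLin
           | Some PCoind => Some PCoind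
           | Some PDag => Some PDag
           | _ => None
           end.

(** (mc): conclusion #Theta,upXi,daggerPsi ; premise daggerXi,daggerPsi *)
Definition boxC_ok (G : env) : Prop := forall i, shared_ok (G i).
Definition boxC_env (G : env) : env :=
  fun i => match G i with
           | Some PCoind | Some PDag => Some PDag
           | _ => None
           end.

(** Inductive typing rules; the coinductive rule (mc) refers to R. *)
Inductive typ_ind (R : env -> pterm -> Prop) : env -> pterm -> Prop :=
| t_var G x :
    (G x = Some PLin \/ G x = Some PHash \/ G x = Some PDag) ->
    (forall y, y <> x -> shared_ok (G y)) ->
    typ_ind R G (Var x)
| t_app G G1 G2 M N :
    app_split G G1 G2 -> typ_ind R G1 M -> typ_ind R G2 N ->
    typ_ind R G (App M N)
| t_lam G M : typ_ind R (ext PLin G) M -> typ_ind R G (Lam M)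
| t_lamI1 G M : typ_ind R (ext PHash G) M -> typ_ind R G (LamI M)
| t_lamI2 G M : typ_ind R (ext PInd G) M -> typ_ind R G (LamI M)
| t_lamC G M : typ_ind R (ext PCoind G) M -> typ_ind R G (LamC M)
| t_boxI G M : boxI_ok G -> typ_ind R (boxI_env G) M -> typ_ind R G (BoxI M)
| t_boxC G M : boxC_ok G -> R (boxC_env G) M -> typ_ind R G (BoxC M).

(** G |- M : derivable by a (possibly infinite) derivation in which every
    infinite branch contains infinitely many (mc). *)
Definition typ (G : env) (M : pterm) : Prop :=
  exists R : env -> pterm -> Prop,
    (forall G' M', R G' M' -> typ_ind R G' M') /\ R G M.

Definition is_term (M : pterm) : Prop :=
  exists G, finite_env G /\ typ G M.

(* Main.v *)
From Stdlib Require Import Arith Lia FunctionalExtensionality ClassicalEpsilon.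
Require Import Defs.

(** Call a step shallow ([step0]) if it is not inside a coinductive box.  On
    terms shallow reduction terminates: fix [n] bounding the number of
    occurrences, outside boxes, of every variable bound by [LamI], and weigh the
    content of an inductive box [n] times; every shallow step then decreases the
    weight and preserves the bound, as in soft linear logic.  Shallow reduction
    is also locally confluent, so every term has a shallow normal form, unique
    up to bisimilarity; normalising the contents of the coinductive boxes in turn
    yields an infinitary normal form [nf M], with [M => nf M].

    It remains to see that [M => N] implies that [nf M] and [nf N] are bisimilar.
    Infinitary joinability, the greatest relation relating [M] and [N] when they
    reduce in finitely many steps to trees that agree outside coinductive boxes
    and have related box contents, contains [=>] and is closed under
    substitution.  As a variable bound by [LamC] occurs only inside coinductive
    boxes, shallow steps can be followed through this agreement, so joinable terms
    have shallow normal forms that agree outside boxes, with box contents linked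
    by finite chains of joinable terms. *)

(** * Bisimilarity, lifting and substitution *)

Definition frob (t : pterm) : pterm :=
  match t with
  | Var n => Var n
  | App a b => App a b
  | Lam a => Lam a
  | LamI a => LamI a
  | LamC a => LamC a
  | BoxI a => BoxI a
  | BoxC a => BoxC a
  end.

Lemma frob_eq t : t = frob t.
Proof. destruct t; reflexivity. Qed.

Ltac unfold_cofix :=
  match goal with |- ?l = _ => rewrite (frob_eq l); reflexivity end.

Lemma lift_var d c n : lift d c (Var n) = Var (if n <? c then n else n + d).
Proof. unfold_cofix. Qed.
Lemma lift_app d c a b : lift d c (App a b) = App (lift d c a) (lift d c b).
Proof. unfold_cofix. Qed.
Lemma lift_lam d c a : lift d c (Lam a) = Lam (lift d (S c) a).
Proof. unfold_cofix. Qed.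
Lemma lift_lamI d c a : lift d c (LamI a) = LamI (lift d (S c) a).
Proof. unfold_cofix. Qed.
Lemma lift_lamC d c a : lift d c (LamC a) = LamC (lift d (S c) a).
Proof. unfold_cofix. Qed.
Lemma lift_boxI d c a : lift d c (BoxI a) = BoxI (lift d c a).
Proof. unfold_cofix. Qed.
Lemma lift_boxC d c a : lift d c (BoxC a) = BoxC (lift d c a).
Proof. unfold_cofix. Qed.

Lemma subst_var k N n :
  subst k N (Var n) =
  if n <? k then Var n else if n =? k then lift k 0 N else Var (n - 1).
Proof.
  etransitivity; [apply frob_eq|].
  change (frob (if n <? k then Var n
                else if n =? k then lift k 0 N else Var (n - 1)) =
          if n <? k then Var n else if n =? k then lift k 0 N else Var (n - 1)).
  symmetry; apply frob_eq.
Qed.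
Lemma subst_app k N a b : subst k N (App a b) = App (subst k N a) (subst k N b).
Proof. unfold_cofix. Qed.
Lemma subst_lam k N a : subst k N (Lam a) = Lam (subst (S k) N a).
Proof. unfold_cofix. Qed.
Lemma subst_lamI k N a : subst k N (LamI a) = LamI (subst (S k) N a).
Proof. unfold_cofix. Qed.
Lemma subst_lamC k N a : subst k N (LamC a) = LamC (subst (S k) N a).
Proof. unfold_cofix. Qed.
Lemma subst_boxI k N a : subst k N (BoxI a) = BoxI (subst k N a).
Proof. unfold_cofix. Qed.
Lemma subst_boxC k N a : subst k N (BoxC a) = BoxC (subst k N a).
Proof. unfold_cofix. Qed.

Hint Rewrite lift_var lift_app lift_lam lift_lamI lift_lamC lift_boxI lift_boxC
  subst_var subst_app subst_lam subst_lamI subst_lamC subst_boxI subst_boxC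
  : unf.

Ltac unf := autorewrite with unf in *.

Ltac ncase :=
  repeat match goal with
  | |- context [?a <? ?b] => destruct (Nat.ltb_spec a b); try lia
  | |- context [?a =? ?b] => destruct (Nat.eqb_spec a b); try lia
  | H : context [?a <? ?b] |- _ => destruct (Nat.ltb_spec a b); try lia
  | H : context [?a =? ?b] |- _ => destruct (Nat.eqb_spec a b); try lia
  end.

Inductive bisimF (R : pterm -> pterm -> Prop) : pterm -> pterm -> Prop :=
| bF_var n : bisimF R (Var n) (Var n)
| bF_app a b a' b' : R a a' -> R b b' -> bisimF R (App a b) (App a' b')
| bF_lam a a' : R a a' -> bisimF R (Lam a) (Lam a')
| bF_lamI a a' : R a a' -> bisimF R (LamI a) (LamI a')
| bF_lamC a a' : R a a' -> bisimF R (LamC a) (LamC a')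
| bF_boxI a a' : R a a' -> bisimF R (BoxI a) (BoxI a')
| bF_boxC a a' : R a a' -> bisimF R (BoxC a) (BoxC a').

(** Replaces guarded [cofix] proofs: a candidate relation is checked one layer at a time, and a case
    may leave it through a known bisimilarity, as happens at variables. *)
Lemma bisim_coind (R : pterm -> pterm -> Prop) :
  (forall a b, R a b -> bisimF R a b \/ bisim a b) ->
  forall a b, R a b -> bisim a b.
Proof.
  intros H; cofix IH; intros a b Hab.
  destruct (H a b Hab) as [F|B]; [|exact B].
  destruct F; constructor; apply IH; assumption.
Qed.

Lemma bisim_refl t : bisim t t.
Proof.
  apply (bisim_coind eq); [|reflexivity].
  intros a b <-; left; destruct a; constructor; reflexivity.
Qed.

Lemma bisim_eq a b : a = b -> bisim a b.
Proof. intros <-; apply bisim_refl. Qed.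

Lemma bisim_sym a b : bisim a b -> bisim b a.
Proof.
  intros H; apply (bisim_coind (fun x y => bisim y x)); [|exact H].
  intros x y E; left; destruct E; constructor; assumption.
Qed.

Lemma bisim_trans a b c : bisim a b -> bisim b c -> bisim a c.
Proof.
  intros H1 H2.
  apply (bisim_coind (fun x z => exists y, bisim x y /\ bisim y z)); [|eauto].
  intros x z [y [E1 E2]]; left.
  destruct E1; inversion E2; subst; constructor; eauto.
Qed.

#[local] Hint Resolve bisim_refl : core.

Ltac coind R := apply (bisim_coind R); [|repeat eexists; eauto; lia].
Ltac bF := constructor; repeat eexists; eauto; try lia; try (repeat f_equal; lia).

Lemma lift_bisim d c t t' : bisim t t' -> bisim (lift d c t) (lift d c t').
Proof.
  intros H.
  coind (fun a b => exists c t t', bisim t t' /\ a = lift d c t /\ b = lift d c t').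
  clear; intros a b (c & t & t' & H & -> & ->); left.
  destruct H; unf; bF.
Qed.

Lemma subst_bisim k N N' t t' :
  bisim N N' -> bisim t t' -> bisim (subst k N t) (subst k N' t').
Proof.
  intros HN H.
  coind (fun a b => exists k t t',
    bisim t t' /\ a = subst k N t /\ b = subst k N' t').
  clear k t t' H; intros a b (k & t & t' & H & -> & ->).
  destruct H; unf; try (left; bF; fail).
  right; ncase; auto using lift_bisim.
Qed.

Lemma lift_lift_merge d c d' c' t :
  c' <= c <= c' + d' -> bisim (lift d c (lift d' c' t)) (lift (d' + d) c' t).
Proof.
  intros H.
  coind (fun a b => exists c c' t, c' <= c <= c' + d' /\
    a = lift d c (lift d' c' t) /\ b = lift (d' + d) c' t).
  clear; intros a b (c & c' & t & H & -> & ->).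
  destruct t; unf; try (left; bF; fail).
  right; apply bisim_eq; f_equal; ncase.
Qed.

Lemma lift_lift_swap d c d' c' t :
  c' <= c -> bisim (lift d (d' + c) (lift d' c' t)) (lift d' c' (lift d c t)).
Proof.
  intros H.
  (* The index [d' + c] becomes a variable [e] with an equation because a binder turns it into
     [S (d' + c)], which is not convertible to [d' + S c]. *)
  coind (fun a b => exists c e c' t, c' <= c /\ e = d' + c /\
    a = lift d e (lift d' c' t) /\ b = lift d' c' (lift d c t)).
  clear; intros a b (c & e & c' & t & H & E & -> & ->).
  destruct t; unf; try (left; bF; fail).
  right; apply bisim_eq; f_equal; ncase.
Qed.

Lemma subst_lift_cancel k N d c t :
  c <= k <= c + d -> bisim (subst k N (lift (S d) c t)) (lift d c t).
Proof.
  intros H.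
  coind (fun a b => exists k c t, c <= k <= c + d /\
    a = subst k N (lift (S d) c t) /\ b = lift d c t).
  clear; intros a b (k & c & t & H & -> & ->).
  destruct t; unf; try (left; bF; fail).
  right; apply bisim_eq; ncase; f_equal; lia.
Qed.

Lemma lift_subst d c j N M :
  bisim (lift d (j + c) (subst j N M)) (subst j (lift d c N) (lift d (S (j + c)) M)).
Proof.
  coind (fun a b => exists j e M, e = j + c /\
    a = lift d e (subst j N M) /\ b = subst j (lift d c N) (lift d (S e) M)).
  clear; intros a b (j & e & M & E & -> & ->).
  destruct M; unf; try (left; bF; fail).
  right; ncase; unf; ncase; auto.
  - subst; apply lift_lift_swap; lia.
  - apply bisim_eq; f_equal; lia.
Qed.

Lemma subst_lift_swap d c k B N :
  c <= k -> bisim (subst (d + k) B (lift d c N)) (lift d c (subst k B N)).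
Proof.
  intros H.
  coind (fun a b => exists k e c N, c <= k /\ e = d + k /\
    a = subst e B (lift d c N) /\ b = lift d c (subst k B N)).
  clear; intros a b (k & e & c & N & H & E & -> & ->).
  destruct N; unf; try (left; bF; fail).
  right; ncase; unf; ncase; auto.
  - subst; apply bisim_sym.
    rewrite (Nat.add_comm d k); apply lift_lift_merge; lia.
  - apply bisim_eq; f_equal; lia.
Qed.

Lemma subst_subst j k B N M :
  bisim (subst (j + k) B (subst j N M)) (subst j (subst k B N) (subst (S (j + k)) B M)).
Proof.
  coind (fun a b => exists j e M, e = j + k /\
    a = subst e B (subst j N M) /\ b = subst j (subst k B N) (subst (S e) B M)).
  clear; intros a b (j & e & M & E & -> & ->).
  destruct M as [n| | | | | | ]; unf; try (left; bF; fail).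
  right; ncase; unf; ncase; auto.
  - subst; apply subst_lift_swap; lia.
  - apply bisim_sym. apply subst_lift_cancel; lia.
Qed.

(** * Finite reduction *)

Inductive step0 : pterm -> pterm -> Prop :=
| s0_base M N : basic M N -> step0 M N
| s0_appl M M' N : step0 M M' -> step0 (App M N) (App M' N)
| s0_appr M N N' : step0 N N' -> step0 (App M N) (App M N')
| s0_lam M M' : step0 M M' -> step0 (Lam M) (Lam M')
| s0_lamI M M' : step0 M M' -> step0 (LamI M) (LamI M')
| s0_lamC M M' : step0 M M' -> step0 (LamC M) (LamC M')
| s0_boxI M M' : step0 M M' -> step0 (BoxI M) (BoxI M').

Inductive steps0 : pterm -> pterm -> Prop :=
| st0_refl M : steps0 M M
| st0_step M N L : step0 M N -> steps0 N L -> steps0 M L.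

#[local] Hint Constructors basic step step0 steps steps0 leadsto : core.

Lemma step0_step M N : step0 M N -> step M N.
Proof. induction 1; auto. Qed.

Lemma steps0_steps M N : steps0 M N -> steps M N.
Proof. induction 1; eauto using step0_step. Qed.

Lemma steps_trans a b c : steps a b -> steps b c -> steps a c.
Proof. induction 1; eauto. Qed.

Lemma steps0_trans a b c : steps0 a b -> steps0 b c -> steps0 a c.
Proof. induction 1; eauto. Qed.

Lemma steps_map (f : pterm -> pterm) :
  (forall a b, step a b -> step (f a) (f b)) ->
  forall a b, steps a b -> steps (f a) (f b).
Proof. induction 2; eauto. Qed.

Lemma steps0_map (f : pterm -> pterm) :
  (forall a b, step0 a b -> step0 (f a) (f b)) ->
  forall a b, steps0 a b -> steps0 (f a) (f b).
Proof. induction 2; eauto. Qed.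

Lemma steps_app a a' b b' : steps a a' -> steps b b' -> steps (App a b) (App a' b').
Proof.
  intros H1 H2; eapply steps_trans.
  - apply (steps_map (fun x => App x b)); eauto.
  - apply (steps_map (App a')); eauto.
Qed.

Lemma steps0_app a a' b b' :
  steps0 a a' -> steps0 b b' -> steps0 (App a b) (App a' b').
Proof.
  intros H1 H2; eapply steps0_trans.
  - apply (steps0_map (fun x => App x b)); eauto.
  - apply (steps0_map (App a')); eauto.
Qed.

(** A contractum is fixed only up to bisimilarity by [basic], so the same [b] serves for both
    redexes. *)
Lemma basic_bisim a a' b : bisim a a' -> basic a b -> basic a' b.
Proof.
  intros E H; destruct H as [M N P H|M N P H|M N P H];
  inversion E as [|? ? ? ? E1 E2| | | | |]; subst;
  inversion E1; subst; try (inversion E2; subst);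
  constructor; eapply bisim_trans; eauto using subst_bisim.
Qed.

Lemma step_bisim a a' b :
  bisim a a' -> step a b -> exists b', step a' b' /\ bisim b b'.
Proof.
  intros E H; revert a' E; induction H; intros a' E;
  [ eauto using basic_bisim | inversion E; subst.. ];
  match goal with
  | IH : forall a', bisim ?M a' -> _, B : bisim ?M _ |- _ =>
      destruct (IH _ B) as (c & ? & ?)
  end; eexists; (split; [eauto|constructor; auto]).
Qed.

Lemma steps_bisim a a' b :
  bisim a a' -> steps a b -> exists b', steps a' b' /\ bisim b b'.
Proof.
  intros E H; revert a' E; induction H; intros a' E; [eauto|].
  destruct (step_bisim _ _ _ E H) as (c & H1 & E1).
  destruct (IHsteps _ E1) as (e & H2 & E2); eauto.
Qed.

Lemma step0_bisim a a' b :
  bisim a a' -> step0 a b -> exists b', step0 a' b' /\ bisim b b'.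
Proof.
  intros E H; revert a' E; induction H; intros a' E;
  [ eauto using basic_bisim | inversion E; subst.. ];
  match goal with
  | IH : forall a', bisim ?M a' -> _, B : bisim ?M _ |- _ =>
      destruct (IH _ B) as (c & ? & ?)
  end; eexists; (split; [eauto|constructor; auto]).
Qed.

Lemma steps0_bisim a a' b :
  bisim a a' -> steps0 a b -> exists b', steps0 a' b' /\ bisim b b'.
Proof.
  intros E H; revert a' E; induction H; intros a' E; [eauto|].
  destruct (step0_bisim _ _ _ E H) as (c & H1 & E1).
  destruct (IHsteps0 _ E1) as (e & H2 & E2); eauto.
Qed.

Lemma basic_lift d c a b : basic a b -> basic (lift d c a) (lift d c b).
Proof.
  intros H; destruct H as [M N P H|M N P H|M N P H]; unf; constructor;
  (eapply bisim_trans; [apply lift_bisim, H | apply (lift_subst d c 0)]).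
Qed.

Lemma basic_subst k B a b : basic a b -> basic (subst k B a) (subst k B b).
Proof.
  intros H; destruct H as [M N P H|M N P H|M N P H]; unf; constructor;
  (eapply bisim_trans; [apply subst_bisim; [|apply H]; auto
                       | apply (subst_subst 0 k)]).
Qed.

Lemma step_lift d c a b : step a b -> step (lift d c a) (lift d c b).
Proof.
  intros H; revert c; induction H; intros c; unf; auto using basic_lift.
Qed.

Lemma step0_lift d c a b : step0 a b -> step0 (lift d c a) (lift d c b).
Proof.
  intros H; revert c; induction H; intros c; unf; auto using basic_lift.
Qed.

Lemma step_subst k B a b : step a b -> step (subst k B a) (subst k B b).
Proof.
  intros H; revert k; induction H; intros k; unf; auto using basic_subst.
Qed.

Lemma step0_subst k B a b : step0 a b -> step0 (subst k B a) (subst k B b).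
Proof.
  intros H; revert k; induction H; intros k; unf; auto using basic_subst.
Qed.

(** * Infinitary joinability *)

Lemma leadsto_mono (R S : pterm -> pterm -> Prop) a b :
  (forall x y, R x y -> S x y) -> leadsto R a b -> leadsto S a b.
Proof. intros H; induction 1; auto. Qed.

Lemma leadsto_sym (R : pterm -> pterm -> Prop) a b :
  leadsto R a b -> leadsto (fun x y => R y x) b a.
Proof. induction 1; auto. Qed.

Lemma leadsto_trans (R : pterm -> pterm -> Prop) a b c :
  (forall x y z, R x y -> R y z -> R x z) ->
  leadsto R a b -> leadsto R b c -> leadsto R a c.
Proof.
  intros T H; revert c; induction H; intros c H'; inversion H'; subst; eauto.
Qed.

Lemma leadsto_bisim (R : pterm -> pterm -> Prop) a b a' b' :
  leadsto R a b -> bisim a a' -> bisim b b' ->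
  leadsto (fun x y => exists x' y', bisim x' x /\ bisim y' y /\ R x' y') a' b'.
Proof.
  intros H; revert a' b'; induction H; intros a' b' E1 E2;
  inversion E1; inversion E2; subst; eauto 8.
Qed.

Definition join_step (R : pterm -> pterm -> Prop) (a b : pterm) : Prop :=
  exists a' b', steps a a' /\ steps b b' /\ leadsto R a' b'.

(** Both sides may reduce, which makes the relation symmetric; transitivity is replaced later by the
    finite chains of [conv]. *)
Definition ijoin (M N : pterm) : Prop :=
  exists R : pterm -> pterm -> Prop,
    (forall a b, R a b -> join_step R a b) /\ R M N.

Lemma join_step_mono (R S : pterm -> pterm -> Prop) a b :
  (forall x y, R x y -> S x y) -> join_step R a b -> join_step S a b.
Proof.
  intros H (a' & b' & H1 & H2 & H3); exists a', b'; eauto using leadsto_mono.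
Qed.

Lemma ijoin_unfold a b : ijoin a b -> join_step ijoin a b.
Proof.
  intros (R & HR & H); apply HR in H; revert H; apply join_step_mono.
  intros x y Hxy; exists R; auto.
Qed.

Lemma ijoin_coind (R : pterm -> pterm -> Prop) :
  (forall a b, R a b -> join_step (fun x y => R x y \/ ijoin x y) a b) ->
  forall a b, R a b -> ijoin a b.
Proof.
  intros H a b Hab; exists (fun x y => R x y \/ ijoin x y); split; [|auto].
  intros x y [Hxy|Hxy]; [auto|].
  eapply join_step_mono; [|apply ijoin_unfold, Hxy]; auto.
Qed.

Lemma ijoin_fold a b : join_step ijoin a b -> ijoin a b.
Proof.
  apply (ijoin_coind (join_step ijoin)); intros x y.
  apply join_step_mono; auto.
Qed.

Lemma ijoin_leadsto a b : leadsto ijoin a b -> ijoin a b.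
Proof. intros H; apply ijoin_fold; exists a, b; auto. Qed.

Lemma ijoin_sym a b : ijoin a b -> ijoin b a.
Proof.
  apply (ijoin_coind (fun x y => ijoin y x)).
  intros x y H; apply ijoin_unfold in H as (y' & x' & H1 & H2 & H3).
  exists x', y'; repeat split; auto.
  apply leadsto_sym in H3; revert H3; apply leadsto_mono; auto.
Qed.

Lemma ijoin_bisim a b a' b' : ijoin a b -> bisim a a' -> bisim b b' -> ijoin a' b'.
Proof.
  intros H Ea Eb.
  apply (ijoin_coind
    (fun x y => exists x' y', bisim x' x /\ bisim y' y /\ ijoin x' y')); [|eauto].
  clear; intros a' b' (a & b & Ea & Eb & H).
  apply ijoin_unfold in H as (a1 & b1 & Ha & Hb & H).
  destruct (steps_bisim _ _ _ Ea Ha) as (a2 & Ha2 & Ea2).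
  destruct (steps_bisim _ _ _ Eb Hb) as (b2 & Hb2 & Eb2).
  exists a2, b2; repeat split; auto.
  eapply leadsto_mono; [|eapply leadsto_bisim; eauto]; auto.
Qed.

Lemma leadsto_ijoin_bisim a b a' b' :
  leadsto ijoin a b -> bisim a a' -> bisim b b' -> leadsto ijoin a' b'.
Proof.
  intros H Ea Eb; eapply leadsto_mono; [|eapply leadsto_bisim; eauto].
  intros x y (x' & y' & H1 & H2 & H3); eauto using ijoin_bisim.
Qed.

Lemma infred_unfold a b :
  infred a b -> exists c, steps a c /\ leadsto infred c b.
Proof.
  intros (R & HR & H); apply HR in H as (c & H1 & H2); exists c; split; [auto|].
  revert H2; apply leadsto_mono; intros x y Hxy; exists R; auto.
Qed.

Lemma infred_ijoin a b : infred a b -> ijoin a b.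
Proof.
  apply (ijoin_coind infred); intros x y H.
  apply infred_unfold in H as (c & H1 & H2); exists c, y; repeat split; auto.
  revert H2; apply leadsto_mono; auto.
Qed.

Lemma join_step_app R a a' b b' :
  join_step R a a' -> join_step R b b' -> join_step R (App a b) (App a' b').
Proof.
  intros (c & c' & H1 & H2 & H3) (e & e' & H4 & H5 & H6).
  exists (App c e), (App c' e'); auto using steps_app.
Qed.

Lemma join_step_cong (f : pterm -> pterm) (R : pterm -> pterm -> Prop) a a' :
  (forall x y, step x y -> step (f x) (f y)) ->
  (forall x y, leadsto R x y -> leadsto R (f x) (f y)) ->
  join_step R a a' -> join_step R (f a) (f a').
Proof.
  intros Hs Hl (c & c' & H1 & H2 & H3).
  exists (f c), (f c'); auto using steps_map.
Qed.

Lemma join_step_leadsto (R : pterm -> pterm -> Prop) a b :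
  leadsto R a b -> join_step R a b.
Proof. intros H; exists a, b; auto. Qed.

Lemma join_step_steps R a a' b b' :
  steps a a' -> steps b b' -> join_step R a' b' -> join_step R a b.
Proof.
  intros Ha Hb (c & c' & H1 & H2 & H3); exists c, c'; eauto using steps_trans.
Qed.

Ltac join_cong :=
  solve [ apply join_step_app; auto
        | apply (join_step_cong Lam); auto
        | apply (join_step_cong LamI); auto
        | apply (join_step_cong LamC); auto
        | apply (join_step_cong BoxI); auto ].

Lemma ijoin_lift d c a b : ijoin a b -> ijoin (lift d c a) (lift d c b).
Proof.
  intros H.
  apply (ijoin_coind
    (fun x y => exists c a b, ijoin a b /\ x = lift d c a /\ y = lift d c b));
  [|eauto 7].
  clear; intros x y (c & a & b & H & -> & ->).
  apply ijoin_unfold in H as (a' & b' & Ha & Hb & H).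
  apply (join_step_steps _ _ (lift d c a') _ (lift d c b'));
  [apply steps_map; auto using step_lift.. |].
  clear Ha Hb; revert c; induction H; intros c; unf; try join_cong.
  - apply join_step_leadsto; auto.
  - apply join_step_leadsto; constructor; left; eauto 7.
Qed.

Lemma leadsto_ijoin_lift d c a b :
  leadsto ijoin a b -> leadsto ijoin (lift d c a) (lift d c b).
Proof.
  intros H; revert c; induction H; intros c; unf; auto using ijoin_lift.
Qed.

(** Reductions of [A] and [B] survive substitution. The finite agreement reached is then traversed,
    and the contents of coinductive boxes fall back to the coinductive hypothesis. *)
Lemma ijoin_subst k a b A B :
  ijoin a b -> ijoin A B -> ijoin (subst k a A) (subst k b B).
Proof.
  intros Hab H.
  apply (ijoin_coind
    (fun x y => exists k A B, ijoin A B /\ x = subst k a A /\ y = subst k b B));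
  [|eauto 7].
  clear A B H; intros x y (l & A & B & H & -> & ->).
  apply ijoin_unfold in H as (A' & B' & HA & HB & H).
  apply (join_step_steps _ _ (subst l a A') _ (subst l b B'));
  [apply steps_map; auto using step_subst.. |].
  clear HA HB; revert l; induction H; intros l; unf; try join_cong.
  - ncase; try (apply join_step_leadsto; auto; fail).
    (* At the replaced variable [a] and [b] must themselves be reduced before they agree, which is
       why the induction proves [join_step] and not [leadsto]. *)
    eapply join_step_mono; [|apply ijoin_unfold, ijoin_lift, Hab]; auto.
  - apply join_step_leadsto; constructor; left; eauto 7.
Qed.

(** * Typing *)

#[local] Hint Constructors typ_ind : core.

Lemma typ_ind_mono (R S : env -> pterm -> Prop) G M :
  (forall G' M', R G' M' -> S G' M') -> typ_ind R G M -> typ_ind S G M.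
Proof. intros H; induction 1; eauto. Qed.

Lemma typ_unfold G M : typ G M -> typ_ind typ G M.
Proof.
  intros (R & HR & H); apply HR in H; revert H; apply typ_ind_mono.
  intros G' M' H; exists R; auto.
Qed.

Lemma typ_coind (R : env -> pterm -> Prop) :
  (forall G M, R G M -> typ_ind (fun G' M' => R G' M' \/ typ G' M') G M) ->
  forall G M, R G M -> typ G M.
Proof.
  intros H G M HR; exists (fun G' M' => R G' M' \/ typ G' M'); split; [|auto].
  intros G' M' [H'|H']; [auto|].
  eapply typ_ind_mono; [|apply typ_unfold, H']; auto.
Qed.

Lemma typ_fold G M : typ_ind typ G M -> typ G M.
Proof.
  apply (typ_coind (typ_ind typ)); intros G' M'; apply typ_ind_mono; auto.
Qed.

Lemma typ_bisim G M M' : bisim M M' -> typ G M -> typ G M'.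
Proof.
  intros E H.
  apply (typ_coind (fun G x => exists y, bisim y x /\ typ G y)); [|eauto].
  clear; intros G x (y & E & H); apply typ_unfold in H.
  revert x E; induction H; intros z E; inversion E; subst; eauto 7.
Qed.

Definition lenv (d c : nat) (G : env) : env :=
  fun i => if i <? c then G i else if i <? c + d then None else G (i - d).

Lemma lenv_zero G : lenv 0 0 G = G.
Proof.
  extensionality i; unfold lenv; rewrite Nat.sub_0_r.
  ncase; reflexivity.
Qed.

Lemma ext_lenv p d c G : ext p (lenv d c G) = lenv d (S c) (ext p G).
Proof.
  extensionality i; destruct i as [|i]; [reflexivity|]; cbn [ext].
  unfold lenv; ncase; auto; replace (S i - d) with (S (i - d)) by lia; reflexivity.
Qed.

Lemma boxI_lenv d c G : boxI_env (lenv d c G) = lenv d c (boxI_env G).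
Proof. extensionality i; unfold boxI_env, lenv; ncase; reflexivity. Qed.

Lemma boxC_lenv d c G : boxC_env (lenv d c G) = lenv d c (boxC_env G).
Proof. extensionality i; unfold boxC_env, lenv; ncase; reflexivity. Qed.

Lemma typ_lift d c G M : typ G M -> typ (lenv d c G) (lift d c M).
Proof.
  intros H.
  apply (typ_coind (fun G' x => exists c G M,
    typ G M /\ G' = lenv d c G /\ x = lift d c M)); [|eauto 7].
  clear; intros G' x (c & G & M & H & -> & ->); apply typ_unfold in H.
  revert c; induction H as [G x H1 H2|G G1 G2 M N HS _ IH1 _ IH2
    |G M _ IH|G M _ IH|G M _ IH|G M _ IH|G M Hb _ IH|G M Hb H]; intros c; unf.
  - constructor.
    + unfold lenv; ncase; rewrite ?Nat.add_sub; auto.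
    + intros y Hy; unfold lenv; revert Hy; ncase; intros Hy; try exact I; apply H2; lia.
  - apply t_app with (lenv d c G1) (lenv d c G2); auto.
    intros i; unfold lenv; ncase; auto; apply HS.
  - constructor; rewrite ext_lenv; auto.
  - apply t_lamI1; rewrite ext_lenv; auto.
  - apply t_lamI2; rewrite ext_lenv; auto.
  - constructor; rewrite ext_lenv; auto.
  - constructor; [|rewrite boxI_lenv; auto].
    intros i; unfold lenv; ncase; try discriminate; apply Hb.
  - constructor; [|rewrite boxC_lenv; eauto 7].
    intros i; unfold lenv; ncase; try exact I; apply Hb.
Qed.

(** The admissible changes of one pattern: weakening by a shared pattern, and turning a linear
    variable into a [PHash] one. The second is needed when a term is copied into several places
    outside boxes. *)
Definition relaxed (h g : option pk) : Prop :=
  match h with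
  | None => shared_ok g
  | Some PLin => g = Some PLin \/ g = Some PHash
  | Some q => g = Some q
  end.

Ltac pk_cases :=
  repeat match goal with
  | H : ?x = Some _ |- _ => is_var x; subst x
  | H : ?x = None |- _ => is_var x; subst x
  | H : _ /\ _ |- _ => destruct H
  | H : _ \/ _ |- _ => destruct H
  | H : Some _ = Some _ |- _ => try discriminate H; clear H
  | H : Some _ = None |- _ => discriminate H
  | H : None = Some _ |- _ => discriminate H
  | H : False |- _ => destruct H
  | x : option pk |- _ => destruct x as [[]|]; cbn in *
  end.

Ltac gen_env i :=
  repeat match goal with
  | H : forall _ : nat, _ |- _ => specialize (H i)
  end;
  repeat match goal with
  | G : env |- _ =>
      let g := fresh "g" in
      generalize dependent (G i); intros g; intros; clear G
  end.

(* Decides pointwise statements about environments by going through all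
   possible patterns at the given index. *)
Ltac pointwise i :=
  unfold app_split, boxI_ok, boxC_ok, boxI_env, boxC_env in *;
  gen_env i; pk_cases; cbn in *; try congruence; auto; try tauto.

Lemma typ_relaxed G G' M :
  (forall i, relaxed (G i) (G' i)) -> typ G M -> typ G' M.
Proof.
  intros E H.
  apply (typ_coind (fun G' M => exists G,
    (forall i, relaxed (G i) (G' i)) /\ typ G M)); [|eauto].
  clear; intros G' M (G & E & H); apply typ_unfold in H.
  assert (X : forall p G G', (forall i, relaxed (G i) (G' i)) ->
    forall i, relaxed (ext p G i) (ext p G' i))
    by (intros [] ? ? ? [|i]; cbn; auto).
  revert G' E; induction H as [G x H1 H2|G G1 G2 M N HS _ IH1 _ IH2
    |G M _ IH|G M _ IH|G M _ IH|G M _ IH|G M Hb _ IH|G M Hb H]; intros G' E.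
  - constructor.
    + clear X H2; specialize (E x); revert E H1; generalize (G x), (G' x).
      intros; pk_cases; auto.
    + intros y Hy; specialize (H2 y Hy); specialize (E y); revert E H2.
      generalize (G y), (G' y); intros; pk_cases; auto.
  - clear X.
    (* A position that is weakened in, or turned from linear into [PHash], must be visible in both
       premises; every other position keeps the pattern of its own premise. *)
    pose (pick := fun (G1 : env) i => match G i with
      | None => G' i
      | Some PLin => match G' i with Some PHash => Some PHash | _ => G1 i end
      | _ => G1 i end).
    apply t_app with (pick G1) (pick G2).
    + clear IH1 IH2; intros i; unfold pick; clear pick; pointwise i.
    + apply IH1; clear IH1 IH2; intros i; unfold pick; clear pick; pointwise i.
    + apply IH2; clear IH1 IH2; intros i; unfold pick; clear pick; pointwise i.
  - constructor; auto.
  - apply t_lamI1; auto.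
  - apply t_lamI2; auto.
  - constructor; auto.
  - clear X; constructor; [clear IH|apply IH; clear IH]; intros i; pointwise i.
  - clear X; constructor; [clear H|left; exists (boxC_env G); split; [clear H|exact H]];
    intros i; pointwise i.
Qed.

(** * Typing of substitution instances *)

Definition del (k : nat) (G : env) : env :=
  fun i => if i <? k then G i else G (S i).

(* [merged p g h] is the pattern of a variable in [M[N/x]] when [x] has pattern
   [p] in [M], and the variable has pattern [g] in [M] and [h] in [N], where [N]
   is taken without the box around it. *)
Definition merged (p g h : option pk) : option pk :=
  match p, h with
  | Some PLin, Some _ => h
  | Some PInd, Some PLin => Some PInd
  | Some PHash, Some PLin => Some PHash
  | _, _ => g
  end.

(** The combinations that firing a redex can meet: [app_split] forces unshared patterns to be absent
    on the other side, and [h] is read after the box has been opened, so that a linear [h] may stem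
    from [PInd]. For [p = None] the replaced variable is absent and nothing is required. *)
Definition compat (p g h : option pk) : Prop :=
  match p, h with
  | None, _ => True
  | _, None => True
  | Some PLin, Some PLin => g = None
  | Some PLin, Some PInd => g = None
  | Some PLin, _ => g = h
  | Some PInd, Some PLin => g = None
  | Some PHash, Some PLin => g = None \/ g = Some PHash
  | Some PInd, Some PCoind => g = h
  | Some PHash, Some PCoind => g = h
  | Some PCoind, Some PDag => g = Some PCoind \/ g = Some PDag
  | Some _, Some PDag => g = h
  | _, _ => False
  end.

(** This and the next two definitions are [app_split], [boxI_env] and [boxC_env] at a single index,
    so that the preservation of [compat] and [merged] becomes a finite case check. *)
Definition split1 (g g1 g2 : option pk) : Prop :=
  match g with
  | None => g1 = None /\ g2 = None
  | Some PLin | Some PInd => (g1 = g /\ g2 = None) \/ (g1 = None /\ g2 = g)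
  | Some _ => g1 = g /\ g2 = g
  end.

Definition boxI1 (o : option pk) : option pk :=
  match o with
  | Some PInd => Some PLin
  | Some PCoind => Some PCoind
  | Some PDag => Some PDag
  | _ => None
  end.

Definition boxC1 (o : option pk) : option pk :=
  match o with
  | Some PCoind | Some PDag => Some PDag
  | _ => None
  end.

Lemma merged_split p p1 p2 g g1 g2 h :
  split1 p p1 p2 -> split1 g g1 g2 -> compat p g h ->
  compat p1 g1 h /\ compat p2 g2 h /\
  split1 (merged p g h) (merged p1 g1 h) (merged p2 g2 h).
Proof.
  intros Hp Hg Hc; destruct p as [[]|], g as [[]|]; cbn in Hp, Hg; pk_cases;
  auto 10; try congruence.
Qed.

Lemma merged_boxI p g h :
  p <> Some PLin -> g <> Some PLin -> compat p g h ->
  compat (boxI1 p) (boxI1 g) h /\ merged p g h <> Some PLin /\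
  boxI1 (merged p g h) = merged (boxI1 p) (boxI1 g) h.
Proof.
  intros Hp Hg Hc; pk_cases; repeat split; auto; try congruence.
Qed.

Lemma merged_boxC p g h :
  shared_ok p -> shared_ok g -> compat p g h ->
  compat (boxC1 p) (boxC1 g) h /\ shared_ok (merged p g h) /\
  boxC1 (merged p g h) = merged (boxC1 p) (boxC1 g) h.
Proof.
  intros Hp Hg Hc; pk_cases; repeat split; auto; try congruence.
Qed.

Lemma del_ext k p G : del (S k) (ext p G) = ext p (del k G).
Proof.
  extensionality i; unfold del; destruct i as [|i]; cbn [ext]; ncase; reflexivity.
Qed.

Lemma lenv_S k G i : lenv (S k) 0 G (S i) = lenv k 0 G i.
Proof. unfold lenv; ncase; reflexivity. Qed.

Definition menv (k : nat) (G H : env) : env :=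
  fun i => merged (G k) (del k G i) (lenv k 0 H i).

Definition mcompat (k : nat) (G H : env) : Prop :=
  forall i, compat (G k) (del k G i) (lenv k 0 H i).

Lemma ext_menv p k G H : ext p (menv k G H) = menv (S k) (ext p G) H.
Proof.
  extensionality i; unfold menv; rewrite del_ext; destruct i as [|i].
  - cbn; destruct (G k) as [[]|]; reflexivity.
  - rewrite lenv_S; reflexivity.
Qed.

Lemma ext_mcompat p k G H : mcompat k G H -> mcompat (S k) (ext p G) H.
Proof.
  intros C i; rewrite del_ext; destruct i as [|i].
  - cbn; destruct (G k) as [[]|]; exact I.
  - rewrite lenv_S; apply C.
Qed.

(** All patterns of the replaced variable are treated at once, since crossing a box changes that
    pattern: [PInd] becomes [PLin] in an inductive box, [PCoind] becomes [PDag] in a coinductive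
    one. *)
Lemma typ_subst k G H M N :
  typ H N -> mcompat k G H -> typ G M -> typ (menv k G H) (subst k N M).
Proof.
  intros HN C HM.
  apply (typ_coind (fun G' x => exists k G M, mcompat k G H /\ typ G M /\
    G' = menv k G H /\ x = subst k N M)); [|eauto 8].
  clear k G M C HM; intros G' y (k & G & M & C & HM & -> & ->).
  apply typ_unfold in HM.
  revert k C; induction HM as [G x H1 H2|G G1 G2 M1 M2 HS _ IH1 _ IH2
    |G M _ IH|G M _ IH|G M _ IH|G M _ IH|G M Hb _ IH|G M Hb HM]; intros k C; unf.
  (* A variable other than [k]: then [k] has a shared pattern or none, and merging spoils neither
     the pattern of [x] nor the sharedness of the rest. *)
  - assert (Hv : x <> k -> forall z, z = (if x <? k then x else x - 1) ->
      typ_ind (fun G' x => (exists k G M, mcompat k G H /\ typ G M /\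
        G' = menv k G H /\ x = subst k N M) \/ typ G' x) (menv k G H) (Var z)).
    { intros Hx z ->; assert (Hk := H2 k ltac:(congruence)).
      constructor.
      - assert (E : del k G (if x <? k then x else x - 1) = G x).
        { unfold del; ncase; f_equal; lia. }
        specialize (C (if x <? k then x else x - 1)); unfold menv; rewrite E in *.
        revert Hk H1 C; generalize (G k), (G x), (lenv k 0 H (if x <? k then x else x - 1)).
        clear; intros; pk_cases; cbn; auto.
      - intros w Hw; specialize (C w); unfold menv.
        assert (S : shared_ok (del k G w)).
        { revert Hw; unfold del; ncase; intros; apply H2; lia. }
        revert Hk S C; generalize (G k), (del k G w), (lenv k 0 H w).
        clear; intros; pk_cases; cbn; auto. }
    ncase; [apply Hv; auto; lia| |apply Hv; auto; lia].
    (* The variable [k] itself: the typing of the lifted [N] is relaxed by the shared rest of [G],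
       and if [k] is [PHash], the linear variables of [N] become [PHash]. *)
    subst x; apply typ_ind_mono with typ; [auto|].
    apply typ_unfold, (typ_relaxed (lenv k 0 H)); [|apply typ_lift, HN].
    intros i; specialize (C i); unfold menv.
    assert (S : shared_ok (del k G i)).
    { unfold del; ncase; intros; apply H2; lia. }
    revert H1 S C; generalize (G k), (del k G i), (lenv k 0 H i).
    clear; intros; pk_cases; cbn; auto.
  - assert (Q : forall i, split1 (del k G i) (del k G1 i) (del k G2 i)).
    { intros i; unfold del; ncase; apply HS. }
    assert (P : split1 (G k) (G1 k) (G2 k)) by apply HS.
    apply t_app with (menv k G1 H) (menv k G2 H).
    + intros i; apply (merged_split _ _ _ _ _ _ _ P (Q i) (C i)).
    + apply IH1; intros i; apply (merged_split _ _ _ _ _ _ _ P (Q i) (C i)).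
    + apply IH2; intros i; apply (merged_split _ _ _ _ _ _ _ P (Q i) (C i)).
  - constructor; rewrite ext_menv; auto using ext_mcompat.
  - apply t_lamI1; rewrite ext_menv; auto using ext_mcompat.
  - apply t_lamI2; rewrite ext_menv; auto using ext_mcompat.
  - constructor; rewrite ext_menv; auto using ext_mcompat.
  - assert (Q : forall i, del k G i <> Some PLin).
    { intros i; unfold del; ncase; apply Hb. }
    assert (E : forall i, del k (boxI_env G) i = boxI1 (del k G i)).
    { intros i; unfold del; ncase; reflexivity. }
    constructor.
    + intros i; apply (merged_boxI _ _ _ (Hb k) (Q i) (C i)).
    + replace (boxI_env (menv k G H)) with (menv k (boxI_env G) H).
      * apply IH; intros i; rewrite E; apply (merged_boxI _ _ _ (Hb k) (Q i) (C i)).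
      * extensionality i; unfold menv at 1; rewrite E; symmetry.
        apply (merged_boxI _ _ _ (Hb k) (Q i) (C i)).
  - assert (Q : forall i, shared_ok (del k G i)).
    { intros i; unfold del; ncase; apply Hb. }
    assert (E : forall i, del k (boxC_env G) i = boxC1 (del k G i)).
    { intros i; unfold del; ncase; reflexivity. }
    constructor.
    + intros i; apply (merged_boxC _ _ _ (Hb k) (Q i) (C i)).
    + replace (boxC_env (menv k G H)) with (menv k (boxC_env G) H).
      * left; exists k, (boxC_env G), M; repeat split; auto.
        intros i; rewrite E; apply (merged_boxC _ _ _ (Hb k) (Q i) (C i)).
      * extensionality i; unfold menv at 1; rewrite E; symmetry.
        apply (merged_boxC _ _ _ (Hb k) (Q i) (C i)).
Qed.

(** * Subject reduction *)

Definition env_le (G G' : env) : Prop :=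
  forall i, G' i = G i \/ (G i = Some PInd /\ G' i = Some PHash).

Lemma env_le_refl G : env_le G G.
Proof. intros i; auto. Qed.

Lemma env_le_trans G1 G2 G3 : env_le G1 G2 -> env_le G2 G3 -> env_le G1 G3.
Proof.
  intros H1 H2 i; specialize (H1 i); specialize (H2 i).
  intuition congruence.
Qed.

(** The environments inside boxes contain no [PInd], so reduction inside a box keeps the
    environment; this is what lets the box rules be reapplied. *)
Lemma env_le_eq G G' : (forall i, G i <> Some PInd) -> env_le G G' -> G' = G.
Proof.
  intros H H'; extensionality i; destruct (H' i) as [|[]]; auto.
  destruct (H i); auto.
Qed.

Lemma env_le_ext p G G' :
  env_le (ext p G) G' -> exists p' G1, G' = ext p' G1 /\ env_le G G1 /\
    (p' = p \/ (p = PInd /\ p' = PHash)).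
Proof.
  intros H; assert (E0 := H 0); cbn in E0.
  exists (match G' 0 with Some q => q | None => p end), (fun i => G' (S i)).
  repeat split.
  - extensionality i; destruct i as [|i]; cbn; auto.
    destruct E0 as [->|[_ ->]]; reflexivity.
  - intros i; apply (H (S i)).
  - destruct E0 as [->|[E ->]]; auto; right; split; congruence.
Qed.

Lemma boxI_env_no_ind G i : boxI_env G i <> Some PInd.
Proof. unfold boxI_env; destruct (G i) as [[]|]; discriminate. Qed.

Lemma boxC_env_no_ind G i : boxC_env G i <> Some PInd.
Proof. unfold boxC_env; destruct (G i) as [[]|]; discriminate. Qed.

Lemma typ_subst0 p G G' H M N P :
  typ (ext p G) M -> typ H N ->
  (forall i, compat (Some p) (G i) (H i)) ->
  (forall i, merged (Some p) (G i) (H i) = G' i) ->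
  bisim P (subst 0 N M) -> typ G' P.
Proof.
  intros HM HN C E B; apply (typ_bisim _ _ _ (bisim_sym _ _ B)).
  replace G' with (menv 0 (ext p G) H).
  - apply typ_subst; auto; intros i; rewrite lenv_zero; apply C.
  - extensionality i; unfold menv; rewrite lenv_zero; apply E.
Qed.

(** Only a [LamI] whose variable is [PHash] changes the environment: the content of its box is
    copied outside boxes, so variables that were [PInd] around the box become [PHash]. The other
    redexes keep [G]. *)
Lemma typ_basic G M N : typ G M -> basic M N -> exists G', env_le G G' /\ typ G' N.
Proof.
  intros HM HB; apply typ_unfold in HM.
  destruct HB as [M N P B|M N P B|M N P B];
  inversion HM as [|? G1 G2 ? ? HS H1 H2| | | | | |]; subst; clear HM;
  inversion H1; subst; clear H1;
  match goal with H : typ_ind typ (ext _ _) _ |- _ => apply typ_fold in H end.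
  - exists G; split; [apply env_le_refl|].
    apply (typ_subst0 PLin G1 G G2 M N); auto using typ_fold;
    clear - HS; intros i; pointwise i.
  - inversion H2 as [| | | | | |? ? Hb HT|]; subst; apply typ_fold in HT.
    exists (fun i => merged (Some PHash) (G1 i) (boxI_env G2 i)); split.
    + clear - HS Hb; intros i; pointwise i.
    + apply (typ_subst0 PHash G1 _ (boxI_env G2) M N); auto.
      clear - HS Hb; intros i; pointwise i.
  - inversion H2 as [| | | | | |? ? Hb HT|]; subst; apply typ_fold in HT.
    exists G; split; [apply env_le_refl|].
    apply (typ_subst0 PInd G1 G (boxI_env G2) M N); auto;
    clear - HS Hb; intros i; pointwise i.
  - inversion H2 as [| | | | | | |? ? Hb HT]; subst.
    exists G; split; [apply env_le_refl|].
    apply (typ_subst0 PCoind G1 G (boxC_env G2) M N); auto;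
    clear - HS Hb; intros i; pointwise i.
Qed.

(** A [PInd] that turns into [PHash] in one premise becomes shared; the other premise had nothing
    there and is weakened by the same [PHash]. *)
Lemma app_split_le_l G G1 G2 G1' :
  app_split G G1 G2 -> env_le G1 G1' ->
  exists G' G2', app_split G' G1' G2' /\ env_le G G' /\
    forall i, relaxed (G2 i) (G2' i).
Proof.
  intros HS HL.
  exists (fun i => match G1 i, G1' i with
                   | Some PInd, Some PHash => Some PHash | _, _ => G i end),
         (fun i => match G1 i, G1' i with
                   | Some PInd, Some PHash => Some PHash | _, _ => G2 i end).
  unfold env_le in *; repeat split; intros i; pointwise i.
Qed.

Lemma app_split_sym G G1 G2 : app_split G G1 G2 -> app_split G G2 G1.
Proof. intros H i; specialize (H i); destruct (G i) as [[]|]; tauto. Qed.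

Lemma typ_step G M N : typ G M -> step M N -> exists G', env_le G G' /\ typ G' N.
Proof.
  intros HM HS; revert G HM; induction HS; intros G HM;
  [eauto using typ_basic | apply typ_unfold in HM; inversion HM; subst; clear HM ..];
  repeat match goal with H : typ_ind typ _ _ |- _ => apply typ_fold in H end;
  match goal with IH : forall G, typ G ?M -> _, HM : typ _ ?M |- _ =>
    destruct (IH _ HM) as (G' & HL & HT) end.
  all: try (apply env_le_ext in HL as (p' & G1' & -> & HL & [->|[Hp ->]]);
    [|try discriminate Hp]; exists G1'; split; auto; apply typ_fold;
    eauto using typ_unfold; fail).
  - match goal with H : app_split _ _ _ |- _ =>
      destruct (app_split_le_l _ _ _ _ H HL) as (G0 & G2' & A1 & A2 & A3) end.
    exists G0; split; auto.
    apply typ_fold, t_app with G' G2'; eauto using typ_unfold, typ_relaxed.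
  - match goal with H : app_split _ _ _ |- _ => apply app_split_sym in H;
      destruct (app_split_le_l _ _ _ _ H HL) as (G0 & G2' & A1 & A2 & A3) end.
    exists G0; split; auto. apply app_split_sym in A1.
    apply typ_fold, t_app with G2' G'; eauto using typ_unfold, typ_relaxed.
  - exists G; split; [apply env_le_refl|].
    apply env_le_eq in HL as ->; [|apply boxI_env_no_ind].
    apply typ_fold; eauto using typ_unfold.
  - exists G; split; [apply env_le_refl|].
    apply env_le_eq in HL as ->; [|apply boxC_env_no_ind].
    apply typ_fold; eauto using typ_unfold.
Qed.

Lemma typ_steps G M N : typ G M -> steps M N -> exists G', env_le G G' /\ typ G' N.
Proof.
  intros HM HS; revert G HM; induction HS; intros G HM; [eauto using env_le_refl|].
  destruct (typ_step _ _ _ HM H) as (G1 & L1 & H1).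
  destruct (IHHS _ H1) as (G2 & L2 & H2); eauto using env_le_trans.
Qed.

Lemma typ_infred G M N : typ G M -> infred M N -> exists G', env_le G G' /\ typ G' N.
Proof.
  (* Coinduction needs one environment for the whole reduction; excluding [PInd] guarantees it, and
     every environment inside a coinductive box satisfies this. *)
  set (R := fun G N => (forall i, G i <> Some PInd) /\ exists M, typ G M /\ infred M N).
  assert (HR : forall G M N, typ_ind typ G M -> leadsto infred M N ->
    typ_ind (fun G' N' => R G' N' \/ typ G' N') G N).
  { clear; intros G M N H; revert N; induction H; intros N' HL;
    inversion HL; subst; eauto.
    constructor; auto; left; split; [apply boxC_env_no_ind|eauto]. }
  assert (HI : forall G N, R G N -> typ G N).
  { apply typ_coind; intros G' N' (HG & M' & HT & HI).
    apply infred_unfold in HI as (c & HS & HL).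
    destruct (typ_steps _ _ _ HT HS) as (G1 & L1 & H1).
    apply env_le_eq in L1 as ->; [|exact HG].
    eauto using typ_unfold. }
  intros HM H; apply infred_unfold in H as (c & HS & HL).
  destruct (typ_steps _ _ _ HM HS) as (G1 & L1 & H1).
  exists G1; split; auto.
  apply typ_fold, typ_ind_mono with (fun G' N' => R G' N' \/ typ G' N').
  - intros ? ? []; auto.
  - eauto using typ_unfold.
Qed.

(** * Strong normalisation at coinductive depth 0 *)

(** The finite part of a term, cut at its coinductive boxes. Typing is inductive there, so typed
    terms have such a skeleton, on which measures can be defined by recursion. *)
Inductive sk : Type :=
| SVar : nat -> sk
| SApp : sk -> sk -> sk
| SLam : sk -> sk
| SLamI : sk -> sk
| SLamC : sk -> sk
| SBoxI : sk -> sk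
| SBoxC : sk.

Inductive shape : pterm -> sk -> Prop :=
| sh_var n : shape (Var n) (SVar n)
| sh_app M N f g : shape M f -> shape N g -> shape (App M N) (SApp f g)
| sh_lam M f : shape M f -> shape (Lam M) (SLam f)
| sh_lamI M f : shape M f -> shape (LamI M) (SLamI f)
| sh_lamC M f : shape M f -> shape (LamC M) (SLamC f)
| sh_boxI M f : shape M f -> shape (BoxI M) (SBoxI f)
| sh_boxC M : shape (BoxC M) SBoxC.

#[local] Hint Constructors shape : core.

#[local] Arguments Nat.ltb : simpl never.
#[local] Arguments Nat.eqb : simpl never.

Fixpoint slift (d c : nat) (t : sk) : sk :=
  match t with
  | SVar n => SVar (if n <? c then n else n + d)
  | SApp a b => SApp (slift d c a) (slift d c b)
  | SLam a => SLam (slift d (S c) a)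
  | SLamI a => SLamI (slift d (S c) a)
  | SLamC a => SLamC (slift d (S c) a)
  | SBoxI a => SBoxI (slift d c a)
  | SBoxC => SBoxC
  end.

Fixpoint ssubst (k : nat) (N t : sk) : sk :=
  match t with
  | SVar n => if n <? k then SVar n
              else if n =? k then slift k 0 N
              else SVar (n - 1)
  | SApp a b => SApp (ssubst k N a) (ssubst k N b)
  | SLam a => SLam (ssubst (S k) N a)
  | SLamI a => SLamI (ssubst (S k) N a)
  | SLamC a => SLamC (ssubst (S k) N a)
  | SBoxI a => SBoxI (ssubst k N a)
  | SBoxC => SBoxC
  end.

(* Occurrences of the variable [k], each counted [n ^ d] times where [d] is the
   number of inductive boxes around it; for [n = 0] only those outside all boxes
   are counted. *)
Fixpoint occ (n k : nat) (t : sk) : nat :=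
  match t with
  | SVar m => if m =? k then 1 else 0
  | SApp a b => occ n k a + occ n k b
  | SLam a | SLamI a | SLamC a => occ n (S k) a
  | SBoxI a => n * occ n k a
  | SBoxC => 0
  end.

Fixpoint wt (n : nat) (t : sk) : nat :=
  match t with
  | SVar _ => 1
  | SApp a b => wt n a + wt n b
  | SLam a | SLamI a | SLamC a => S (wt n a)
  | SBoxI a => S (n * wt n a)
  | SBoxC => 1
  end.

Fixpoint bounded (n : nat) (t : sk) : Prop :=
  match t with
  | SVar _ | SBoxC => True
  | SApp a b => bounded n a /\ bounded n b
  | SLam a | SLamC a | SBoxI a => bounded n a
  | SLamI a => occ 0 0 a <= n /\ bounded n a
  end.

Lemma shape_lift d c M f : shape M f -> shape (lift d c M) (slift d c f).
Proof. intros H; revert c; induction H; intros c; unf; cbn; auto. Qed.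

Lemma shape_subst k M N f g :
  shape N g -> shape M f -> shape (subst k N M) (ssubst k g f).
Proof.
  intros HN H; revert k; induction H; intros k; unf; cbn; auto.
  ncase; auto using shape_lift.
Qed.

Lemma shape_bisim M M' f : bisim M M' -> shape M f -> shape M' f.
Proof.
  intros E H; revert M' E; induction H; intros M' E; inversion E; subst; auto.
Qed.

Lemma typ_ind_shape R G M : typ_ind R G M -> exists f, shape M f.
Proof.
  induction 1; repeat match goal with H : exists _, _ |- _ => destruct H end; eauto.
Qed.

Lemma occ_slift_lt n d c k f : k < c -> occ n k (slift d c f) = occ n k f.
Proof.
  revert c k; induction f; intros c k H; cbn; auto; try (apply IHf; lia).
  - ncase.
Qed.

Lemma occ_slift_mid n d c k f : c <= k < c + d -> occ n k (slift d c f) = 0.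
Proof.
  revert c k; induction f; intros c k H; cbn; auto; try (apply IHf; lia).
  - ncase.
  - rewrite IHf1, IHf2; lia.
  - rewrite IHf; lia.
Qed.

Lemma occ_slift_ge n d c k f : c <= k -> occ n (d + k) (slift d c f) = occ n k f.
Proof.
  revert c k; induction f; intros c k H; cbn; auto;
  try (rewrite <- Nat.add_succ_r; apply IHf; lia).
  - ncase.
Qed.

Lemma occ_ssubst_lt n j k g f : j < k -> occ n j (ssubst k g f) = occ n j f.
Proof.
  revert j k; induction f; intros j k H; cbn; auto; try (apply IHf; lia).
  ncase; cbn; ncase; apply occ_slift_mid; lia.
Qed.

Lemma occ_ssubst_ge n j k g f :
  occ n (k + j) (ssubst k g f) = occ n (S (k + j)) f + occ n k f * occ n j g.
Proof.
  revert k; induction f; intros k; cbn; auto;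
  try (rewrite <- Nat.add_succ_l; apply IHf).
  - ncase; cbn; ncase. rewrite occ_slift_ge; lia.
  - rewrite IHf1, IHf2; lia.
  - rewrite IHf; lia.
Qed.

Lemma wt_slift n d c f : wt n (slift d c f) = wt n f.
Proof. revert c; induction f; intros c; cbn; auto. Qed.

Lemma wt_pos n f : 1 <= wt n f.
Proof. induction f; cbn; lia. Qed.

(** Each occurrence trades weight 1 for [wt n g], multiplied by [n] for every inductive box around
    it, which is what [occ n] counts. The additive form avoids truncated subtraction. *)
Lemma wt_ssubst n k g f :
  wt n (ssubst k g f) + occ n k f = wt n f + occ n k f * wt n g.
Proof.
  revert k; induction f; intros k; cbn; auto; try (rewrite <- IHf; lia).
  - ncase; cbn; rewrite ?wt_slift; lia.
  - specialize (IHf1 k); specialize (IHf2 k); lia.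
  - specialize (IHf k); nia.
Qed.

Lemma bounded_slift n d c f : bounded n f -> bounded n (slift d c f).
Proof.
  revert c; induction f; intros c; cbn; intuition auto.
  rewrite occ_slift_lt; lia.
Qed.

Lemma bounded_ssubst n k g f : bounded n g -> bounded n f -> bounded n (ssubst k g f).
Proof.
  intros Hg; revert k; induction f; intros k; cbn; intuition auto.
  - ncase; cbn; auto using bounded_slift.
  - rewrite occ_ssubst_lt; lia.
Qed.

Lemma bounded_exists f : exists n, 1 <= n /\ bounded n f.
Proof.
  assert (mono : forall n m f, n <= m -> bounded n f -> bounded m f).
  { intros n m g H; induction g; cbn; intuition lia. }
  induction f; cbn.
  2: { destruct IHf1 as (n1 & ? & ?), IHf2 as (n2 & ? & ?).
       exists (n1 + n2); repeat split; try lia;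
       [apply (mono n1)|apply (mono n2)]; auto; lia. }
  3: { destruct IHf as (n & ? & ?); exists (n + occ 0 0 f); repeat split; try lia.
       apply (mono n); auto; lia. }
  all: eauto; exists 1; auto.
Qed.

(** The quantitative content of the patterns: a linear variable occurs once, outside boxes; an
    inductive one once, under exactly one inductive box; a [PHash] one never in a box, so that the
    box weight is irrelevant; a coinductive one only inside coinductive boxes. *)
Lemma typ_occ R G M f n k :
  typ_ind R G M -> shape M f ->
  match G k with
  | None | Some PCoind => occ n k f = 0
  | Some PLin => occ n k f = 1
  | Some PInd => occ n k f = n
  | Some PHash => occ n k f = occ 0 k f
  | Some PDag => True
  end.
Proof.
  intros H; revert k f; induction H as [G x H1 H2|G G1 G2 M1 M2 HS _ IH1 _ IH2
    |G M _ IH|G M _ IH|G M _ IH|G M _ IH|G M Hb _ IH|G M Hb HM];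
  intros k f' Hf; inversion Hf; subst; cbn; try (apply (IH (S k)); assumption).
  - ncase; [subst; destruct H1 as [->|[->| ->]]; auto|].
    specialize (H2 k ltac:(congruence)); destruct (G k) as [[]|]; auto; destruct H2.
  - specialize (HS k).
    specialize (IH1 k f ltac:(assumption)); specialize (IH2 k g ltac:(assumption)).
    revert HS IH1 IH2; generalize (G k), (G1 k), (G2 k); intros; pk_cases; auto; try lia; congruence.
  - specialize (Hb k); specialize (IH k f ltac:(assumption)); unfold boxI_env in IH.
    destruct (G k) as [[]|]; try congruence; try (rewrite IH; lia); auto; lia.
  - specialize (Hb k); destruct (G k) as [[]|]; auto; destruct Hb.
Qed.

(** A [PInd] variable may be copied when its box is opened, but at most [n] times; this is enough
    for the bound on [LamI] to survive. [PDag] is unconstrained because no binder introduces it. *)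
Definition occ_grows (n : nat) (g : option pk) (m m' : nat) : Prop :=
  match g with
  | Some PInd => m' <= n
  | Some PDag => True
  | _ => m' <= m
  end.

Definition decreases (n : nat) (G : env) (f f' : sk) : Prop :=
  bounded n f' /\ wt n f' < wt n f /\
  forall y, occ_grows n (G y) (occ 0 y f) (occ 0 y f').

(** For [LamI], the argument is charged [n] times in its box. It replaces either at most [n]
    occurrences outside boxes, or a single one inside a box, again counted [n] times; the
    constructors that vanish give the strict decrease. A linear variable is replaced once, a
    coinductive one nowhere in the skeleton. *)
Lemma basic_decreases n G M N f :
  typ_ind typ G M -> shape M f -> bounded n f -> basic M N ->
  exists f', shape N f' /\ decreases n G f f'.
Proof.
  intros HM Hf Hb HB.
  destruct HB as [M N P B|M N P B|M N P B];
  inversion HM as [|? G1 G2 ? ? HS H1 H2| | | | | |]; subst;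
  inversion Hf as [|? ? f1 f2 Hf1 Hf2| | | | |]; subst;
  inversion Hf1; subst; inversion H1; subst; clear H1 Hf1;
  match goal with HA : shape M ?a, HT : typ_ind typ (ext _ _) M |- _ =>
    rename a into f1; rename HA into Hf1;
    assert (O := fun n k => typ_occ _ _ _ _ n k HT Hf1) end;
  assert (Ok := O n 0); assert (O0 := O 0 0); cbn in Ok, O0;
  assert (O1 := fun y => O 0 (S y)); cbn in O1.
  - exists (ssubst 0 f2 f1); split; [|split; [|split]].
    + eapply shape_bisim; [apply bisim_sym, B|]; auto using shape_subst.
    + cbn in Hb; apply bounded_ssubst; tauto.
    + assert (W := wt_ssubst n 0 f2 f1); cbn; rewrite Ok in W; lia.
    + intros y; rewrite (occ_ssubst_ge 0 y 0), O0; cbn.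
      assert (T := typ_occ _ _ _ _ 0 y HM Hf); cbn in T; revert T.
      destruct (G y) as [[]|]; cbn; intros; auto; lia.
  - inversion Hf2 as [| | | | |? g Hg|]; subst; inversion H2; subst; clear H2 Hf2.
    assert (Og := fun y => typ_occ _ _ _ _ 0 y ltac:(eassumption) Hg).
    cbn in Hb.
    exists (ssubst 0 g f1); split; [|split; [|split]].
    + eapply shape_bisim; [apply bisim_sym, B|]; auto using shape_subst.
    + apply bounded_ssubst; tauto.
    + assert (W := wt_ssubst n 0 g f1); cbn; rewrite Ok in W.
      assert (P1 := wt_pos n g); nia.
    + intros y; rewrite (occ_ssubst_ge 0 y 0); cbn.
      assert (Hb0 : occ 0 0 f1 <= n) by tauto.
      specialize (HS y); specialize (O1 y); specialize (Og y); unfold boxI_env in Og.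
      revert HS O1 Og; generalize (G y), (G1 y), (G2 y); intros; pk_cases; auto; nia.
  - inversion Hf2 as [| | | | |? g Hg|]; subst; inversion H2; subst; clear H2 Hf2.
    cbn in Hb.
    exists (ssubst 0 g f1); split; [|split; [|split]].
    + eapply shape_bisim; [apply bisim_sym, B|]; auto using shape_subst.
    + apply bounded_ssubst; tauto.
    + assert (W := wt_ssubst n 0 g f1); cbn; rewrite Ok in W; lia.
    + intros y; rewrite (occ_ssubst_ge 0 y 0), O0; cbn.
      assert (T := typ_occ _ _ _ _ 0 y HM Hf); cbn in T; revert T.
      destruct (G y) as [[]|]; cbn; intros; auto; lia.
  - inversion Hf2; subst; inversion H2 as [| | | | | | |? ? ? HN]; subst; clear H2 Hf2.
    apply typ_unfold in HN.
    destruct (typ_ind_shape _ _ _ HN) as [g Hg].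
    assert (Hs : forall h, shape P (ssubst 0 h f1)).
    { intros h; replace (ssubst 0 h f1) with (ssubst 0 g f1).
      - eapply shape_bisim; [apply bisim_sym, B|]; auto using shape_subst.
      (* With box weight 1 every occurrence in the skeleton is counted, so a zero count means
         absence. *)
      - assert (U : forall k a, occ 1 k a = 0 -> ssubst k g a = ssubst k h a).
        { clear; intros k a; revert k; induction a; intros k; cbn; intros;
          f_equal; auto; try (apply IHa; lia); try (apply IHa1; lia);
          try (apply IHa2; lia). ncase; auto. }
        apply U, (O 1 0). }
    (* The variable does not occur in [f1]; [SBoxC] is substituted rather than [g]
       because [g], coming from a coinductive box, need not be bounded by [n]. *)
    cbn in Hb; exists (ssubst 0 SBoxC f1); split; [auto|split; [|split]].
    + apply bounded_ssubst; cbn; tauto.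
    + assert (W := wt_ssubst n 0 SBoxC f1); cbn; rewrite Ok in W; lia.
    + intros y; rewrite (occ_ssubst_ge 0 y 0), O0; cbn.
      assert (T := typ_occ _ _ _ _ 0 y HM Hf); cbn in T; revert T.
      destruct (G y) as [[]|]; cbn; intros; auto; lia.
Qed.

(** A loss inside an inductive box is multiplied by [n], hence [1 <= n]. Under a [LamI], [occ_grows]
    at the bound variable restores the bound: whether it was [PHash] or [PInd], its new count is at
    most [n]. *)
Lemma step0_decreases n G M N f :
  1 <= n -> typ_ind typ G M -> shape M f -> bounded n f -> step0 M N ->
  exists f', shape N f' /\ decreases n G f f'.
Proof.
  intros Hn HM Hf Hb HS; revert G f HM Hf Hb.
  induction HS; intros G f0 HM Hf Hb; [eauto using basic_decreases|..];
  inversion Hf; subst; inversion HM; subst; cbn in Hb;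
  match goal with
  | IH : forall G f, typ_ind typ G ?M -> _, T : typ_ind typ _ ?M, H : shape ?M _ |- _ =>
      destruct (IH _ _ T H ltac:(tauto)) as (f' & S' & B' & W' & O')
  end.
  - match goal with A : app_split _ _ _, T1 : typ_ind typ _ M, S1 : shape M _,
      T2 : typ_ind typ _ N, S2 : shape N _ |- _ =>
      rename A into A'; assert (Of := fun y => typ_occ _ _ _ _ 0 y T1 S1);
      assert (Og := fun y => typ_occ _ _ _ _ 0 y T2 S2) end.
    eexists; split; [eauto|split; [|split]]; cbn; [tauto|lia|].
    intros y; specialize (A' y); specialize (O' y); specialize (Of y);
    specialize (Og y); revert A' O' Of Og.
    generalize (G y), (G1 y), (G2 y); intros; pk_cases; auto; lia.
  - match goal with A : app_split _ _ _, T1 : typ_ind typ _ M, S1 : shape M _,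
      T2 : typ_ind typ _ N, S2 : shape N _ |- _ =>
      rename A into A'; assert (Of := fun y => typ_occ _ _ _ _ 0 y T1 S1);
      assert (Og := fun y => typ_occ _ _ _ _ 0 y T2 S2) end.
    eexists; split; [eauto|split; [|split]]; cbn; [tauto|lia|].
    intros y; specialize (A' y); specialize (O' y); specialize (Of y);
    specialize (Og y); revert A' O' Of Og.
    generalize (G y), (G1 y), (G2 y); intros; pk_cases; auto; lia.
  - eexists; split; [eauto|split; [|split]]; cbn; [tauto|lia|].
    intros y; apply (O' (S y)).
  - eexists; split; [eauto|split; [|split]]; cbn; [|lia|intros y; apply (O' (S y))].
    assert (O0 := O' 0); cbn in O0; split; [lia|auto].
  - eexists; split; [eauto|split; [|split]]; cbn; [|lia|intros y; apply (O' (S y))].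
    assert (O0 := O' 0); cbn in O0; split; [lia|auto].
  - eexists; split; [eauto|split; [|split]]; cbn; [tauto|lia|].
    intros y; apply (O' (S y)).
  - eexists; split; [eauto|split; [|split]]; cbn; [tauto|nia|].
    intros y; destruct (G y) as [[]|]; cbn; auto; lia.
Qed.

Definition wf (M : pterm) : Prop := exists G, typ G M.

Lemma wf_step M N : wf M -> step M N -> wf N.
Proof. intros [G H] HS; destruct (typ_step _ _ _ H HS) as (G' & _ & H'); exists G'; auto. Qed.

Lemma wf_steps M N : wf M -> steps M N -> wf N.
Proof. intros H HS; induction HS; eauto using wf_step. Qed.

Lemma wf_SN M : wf M -> Acc (fun b a => step0 a b) M.
Proof.
  intros [G H].
  destruct (typ_ind_shape _ _ _ (typ_unfold _ _ H)) as [f Hf].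
  destruct (bounded_exists f) as (n & Hn & Hb).
  remember (wt n f) as w eqn:E; revert G M f E H Hf Hb.
  induction w as [w IH] using lt_wf_ind; intros G M f -> H Hf Hb.
  constructor; intros N HN.
  destruct (step0_decreases n G M N f) as (f' & Hf' & Hb' & W & _);
    auto using typ_unfold.
  destruct (typ_step _ _ _ H (step0_step _ _ HN)) as (G' & _ & H').
  eapply IH; eauto.
Qed.

(** * Confluence at coinductive depth 0 *)

Lemma typ_subst_absent k G M B B' :
  typ G M -> G k = None -> bisim (subst k B M) (subst k B' M).
Proof.
  intros HM Hk.
  apply (bisim_coind (fun a b => exists k G M, typ G M /\ G k = None /\
    a = subst k B M /\ b = subst k B' M)); [|exists k, G, M; auto].
  clear; intros a b (k & G & M & HM & Hk & -> & ->).
  apply typ_unfold in HM.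
  destruct HM as [G x H1 H2|G G1 G2 M N HS H1 H2|G M H|G M H|G M H|G M H|G M Hb H|G M Hb H];
  unf; repeat match goal with H : typ_ind typ _ _ |- _ => apply typ_fold in H end.
  - right; ncase; auto.
    subst; exfalso; rewrite Hk in H1; intuition discriminate.
  - specialize (HS k); rewrite Hk in HS; destruct HS.
    left; constructor; [exists k, G1, M|exists k, G2, N]; auto.
  - left; constructor; exists (S k), (ext PLin G), M; auto.
  - left; constructor; exists (S k), (ext PHash G), M; auto.
  - left; constructor; exists (S k), (ext PInd G), M; auto.
  - left; constructor; exists (S k), (ext PCoind G), M; auto.
  - left; constructor; exists k, (boxI_env G), M; repeat split; auto.
    unfold boxI_env; rewrite Hk; auto.
  - left; constructor; exists k, (boxC_env G), M; repeat split; auto.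
    unfold boxC_env; rewrite Hk; auto.
Qed.

(** The step is repeated in each of the finitely many copies. The conditions on [G k] keep the
    variable out of coinductive boxes, where no shallow step could follow. *)
Lemma step0_subst_arg k G A B B' :
  typ_ind typ G A -> G k <> Some PCoind -> G k <> Some PDag -> step0 B B' ->
  exists c, steps0 (subst k B A) c /\ bisim c (subst k B' A).
Proof.
  intros HA HC HD HB; revert k HC HD.
  induction HA as [G x H1 H2|G G1 G2 M N HS _ IH1 _ IH2
    |G M _ IH|G M _ IH|G M _ IH|G M _ IH|G M Hb _ IH|G M Hb HM];
  intros k HC HD; unf.
  - ncase; eauto using step0_lift.
  - assert (X : (G1 k = G k \/ G1 k = None) /\ (G2 k = G k \/ G2 k = None)).
    { specialize (HS k); destruct (G k) as [[]|]; tauto. }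
    destruct (IH1 k) as (c1 & H1 & E1); try (intuition congruence).
    destruct (IH2 k) as (c2 & H2 & E2); try (intuition congruence).
    exists (App c1 c2); split; [auto using steps0_app|constructor; auto].
  - destruct (IH (S k)) as (c & H & E); auto; exists (Lam c); split;
    [apply (steps0_map Lam); auto|constructor; auto].
  - destruct (IH (S k)) as (c & H & E); auto; exists (LamI c); split;
    [apply (steps0_map LamI); auto|constructor; auto].
  - destruct (IH (S k)) as (c & H & E); auto; exists (LamI c); split;
    [apply (steps0_map LamI); auto|constructor; auto].
  - destruct (IH (S k)) as (c & H & E); auto; exists (LamC c); split;
    [apply (steps0_map LamC); auto|constructor; auto].
  - destruct (IH k) as (c & H & E);
    [unfold boxI_env; destruct (G k) as [[]|]; congruence..|].
    exists (BoxI c); split; [apply (steps0_map BoxI); auto|constructor; auto].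
  - exists (BoxC (subst k B M)); split; [auto|constructor].
    apply typ_subst_absent with (boxC_env G); auto.
    unfold boxC_env; specialize (Hb k); destruct (G k) as [[]|]; cbn in Hb; tauto.
Qed.

Definition join0 (a b : pterm) : Prop :=
  exists c d, steps0 a c /\ steps0 b d /\ bisim c d.

Lemma join0_sym a b : join0 a b -> join0 b a.
Proof. intros (c & d & H1 & H2 & H3); exists d, c; auto using bisim_sym. Qed.

Lemma join0_bisim_l a a' b : bisim a a' -> join0 a b -> join0 a' b.
Proof.
  intros E (c & d & H1 & H2 & H3).
  destruct (steps0_bisim _ _ _ E H1) as (c' & H1' & E').
  exists c', d; eauto using bisim_trans, bisim_sym.
Qed.

Lemma join0_cong (f : pterm -> pterm) a b :
  (forall x y, step0 x y -> step0 (f x) (f y)) ->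
  (forall x y, bisim x y -> bisim (f x) (f y)) ->
  join0 a b -> join0 (f a) (f b).
Proof.
  intros Hs He (c & d & H1 & H2 & H3).
  exists (f c), (f d); auto using steps0_map.
Qed.

#[local] Hint Constructors bisim : core.

Lemma basic_body_join A A' B a :
  bisim a (subst 0 B A) -> step0 A A' -> join0 a (subst 0 B A').
Proof.
  intros E H; apply join0_bisim_l with (subst 0 B A); [apply bisim_sym, E|].
  exists (subst 0 B A'), (subst 0 B A'); eauto using step0_subst.
Qed.

Lemma basic_arg_join G A B B' a p :
  typ_ind typ (ext p G) A -> p <> PCoind -> p <> PDag ->
  bisim a (subst 0 B A) -> step0 B B' -> join0 a (subst 0 B' A).
Proof.
  intros HA H1 H2 E H; apply join0_bisim_l with (subst 0 B A); [apply bisim_sym, E|].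
  destruct (step0_subst_arg 0 _ A B B' HA) as (c & H3 & H4); cbn; try congruence.
  exists c, (subst 0 B' A); auto.
Qed.

Lemma join0_step_r a b c : step0 b c -> join0 a c -> join0 a b.
Proof. intros H (x & y & H1 & H2 & H3); exists x, y; eauto. Qed.

Lemma basic_step0_join G M a b :
  typ_ind typ G M -> basic M a -> step0 M b -> join0 a b.
Proof.
  intros HM Ha Hb.
  destruct Ha as [M N P B|M N P B|M N P B]; inversion Hb as
    [? ? Hb1|? M1 ? Hb1|? ? N1 Hb1| | | |]; subst; clear Hb.
  (* Both steps contract the root redex, whose contractum is unique up to bisimilarity. *)
  1,4,7: inversion Hb1; subst; exists P, b; repeat split; auto;
    eapply bisim_trans; eauto using bisim_sym.
  (* The other step lies in the body of the abstraction. *)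
  1,3,5: inversion Hb1 as [? ? Hb2|? | | | | | ]; subst; [inversion Hb2|];
    eapply join0_step_r; [|eapply basic_body_join; eauto]; auto.
  (* The argument of a [LamC] redex is a coinductive box, which admits no shallow step. *)
  3: inversion Hb1 as [? ? Hb2| | | | | | ]; subst; inversion Hb2.
  - inversion HM as [|? G1 G2 ? ? HS H1 H2| | | | | |]; subst; inversion H1; subst.
    eapply join0_step_r;
    [|eapply (basic_arg_join G1 _ _ _ _ PLin); eauto; discriminate]; auto.
  - inversion Hb1 as [? ? Hb2| | | | | |? N2 Hb2]; subst; [inversion Hb2|].
    inversion HM as [|? G1 G2 ? ? HS H1 H2| | | | | |]; subst;
    inversion H1; subst; (eapply join0_step_r;
    [|eapply (basic_arg_join G1 _ _ _ _); eauto; discriminate]); auto.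
Qed.

Lemma step0_local_confluence G M a b :
  typ_ind typ G M -> step0 M a -> step0 M b -> join0 a b.
Proof.
  intros HM Ha; revert G b HM.
  induction Ha as [M a Ha|M a N Ha IH|M N a Ha IH|M a Ha IH|M a Ha IH|M a Ha IH|M a Ha IH];
  intros G b HM Hb; [eauto using basic_step0_join|..];
  (inversion Hb as [? ? Hb1|? ? ? Hb1|? ? ? Hb1|? ? Hb1|? ? Hb1|? ? Hb1|? ? Hb1]; subst;
   [apply join0_sym; eapply basic_step0_join; eauto|..]).
  - inversion HM; subst; apply (join0_cong (fun x => App x N)); eauto.
  - exists (App a N'), (App a N'); repeat split; eauto.
  - exists (App M' a), (App M' a); repeat split; eauto.
  - inversion HM; subst; apply (join0_cong (App M)); eauto.
  - inversion HM; subst; apply (join0_cong Lam); eauto.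
  - inversion HM; subst; apply (join0_cong LamI); eauto.
  - inversion HM; subst; apply (join0_cong LamC); eauto.
  - inversion HM; subst; apply (join0_cong BoxI); eauto.
Qed.

(** Newman's lemma up to bisimilarity: each use of an induction hypothesis requires moving a
    reduction across a bisimilarity. *)
Lemma wf_confluence0 M a b : wf M -> steps0 M a -> steps0 M b -> join0 a b.
Proof.
  intros HM; assert (HA := wf_SN M HM); revert a b HM.
  induction HA as [M _ IH]; intros a b HM Ha Hb.
  destruct Ha as [|M M1 a H1 Ha]; [exists b, b; auto|].
  destruct Hb as [|M M2 b H2 Hb]; [exists a, a; eauto|].
  assert (W1 : wf M1) by eauto using wf_step, step0_step.
  assert (W2 : wf M2) by eauto using wf_step, step0_step.
  destruct HM as [G HM]; apply typ_unfold in HM.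
  destruct (step0_local_confluence _ _ _ _ HM H1 H2) as (c1 & c2 & C1 & C2 & E).
  destruct (IH M1 H1 a c1 W1 Ha C1) as (a' & e & A1 & A2 & E1).
  destruct (steps0_bisim _ _ _ E A2) as (e' & A3 & E2).
  destruct (IH M2 H2 b e' W2 Hb (steps0_trans _ _ _ C2 A3)) as (b' & e2 & B1 & B2 & E3).
  assert (E4 : bisim e' a') by eauto using bisim_trans, bisim_sym.
  destruct (steps0_bisim _ _ _ E4 B2) as (a2 & A4 & E5).
  exists a2, b'; repeat split; eauto using steps0_trans, bisim_trans, bisim_sym.
Qed.

Definition normal0 (M : pterm) : Prop := forall N, ~ step0 M N.

Lemma normal0_steps M N : normal0 M -> steps0 M N -> N = M.
Proof. intros H HS; inversion HS as [|? ? ? H1]; subst; [auto|]; destruct (H _ H1). Qed.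

Lemma wf_normal0_exists M : wf M -> exists N, steps0 M N /\ normal0 N.
Proof.
  intros HM; assert (HA := wf_SN M HM); induction HA as [M _ IH].
  destruct (classic (exists N, step0 M N)) as [[N HN]|HN].
  - destruct (IH N HN) as (P & H1 & H2); eauto using wf_step, step0_step.
  - exists M; split; [auto|]; intros N H; eauto.
Qed.

Lemma normal0_unique M a b :
  wf M -> steps0 M a -> normal0 a -> steps0 M b -> normal0 b -> bisim a b.
Proof.
  intros HM Ha Na Hb Nb.
  destruct (wf_confluence0 _ _ _ HM Ha Hb) as (c & d & H1 & H2 & E).
  apply normal0_steps in H1 as ->, H2 as ->; auto.
Qed.

(** Normal forms are chosen by a total function so that [gen] can call it on arbitrary preterms; the
    value is meaningful on [wf] terms. *)
Definition nf0 (M : pterm) : pterm :=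
  epsilon (inhabits M) (fun N => steps0 M N /\ normal0 N).

Lemma nf0_spec M : wf M -> steps0 M (nf0 M) /\ normal0 (nf0 M).
Proof. intros H; exact (epsilon_spec (inhabits M) _ (wf_normal0_exists M H)). Qed.

Lemma wf_nf0 M : wf M -> wf (nf0 M).
Proof. intros H; eapply wf_steps; [exact H|]; apply steps0_steps, nf0_spec, H. Qed.

(** * Infinitary normal forms *)

(** Typing is essential even for reflexivity, because [leadsto] is inductive and so needs a tree
    that is finite outside coinductive boxes. *)
Lemma wf_bisim_ijoin M N : wf M -> bisim M N -> ijoin M N.
Proof.
  intros HM E; apply (ijoin_coind (fun a b => wf a /\ bisim a b)); [|auto].
  clear; intros M N [[G HM] E]; apply join_step_leadsto; apply typ_unfold in HM.
  revert N E; induction HM; intros N' E; inversion E; subst; auto.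
  constructor; left; split; [eexists; eassumption|auto].
Qed.

Lemma typ_bisim_leadsto G M N :
  typ_ind typ G M -> bisim M N -> leadsto ijoin M N.
Proof.
  intros HM; revert N; induction HM; intros N' E; inversion E; subst; auto.
  constructor; apply wf_bisim_ijoin; [eexists; eassumption|auto].
Qed.

Lemma wf_bisim_leadsto M N : wf M -> bisim M N -> leadsto ijoin M N.
Proof. intros [G H]; eapply typ_bisim_leadsto, typ_unfold, H. Qed.

Lemma wf_step_ijoin M N : wf M -> step M N -> ijoin M N.
Proof.
  intros HM HS; apply ijoin_fold; exists N, N; repeat split; eauto.
  apply wf_bisim_leadsto; eauto using wf_step.
Qed.

(** A step inside a coinductive box leaves everything outside unchanged and relates the contents by
    [ijoin]. *)
Lemma step_cases G M N :
  typ_ind typ G M -> step M N -> step0 M N \/ leadsto ijoin M N.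
Proof.
  intros HM HS; revert G HM; induction HS; intros G HM;
  [auto|inversion HM; subst..];
  try match goal with
  | IH : forall G, typ_ind typ G ?M -> _, HM : typ_ind typ _ ?M |- _ =>
      destruct (IH _ HM); [left; auto; fail|right]
  end; eauto using typ_bisim_leadsto.
  right; constructor; apply wf_step_ijoin; [eexists; eassumption|auto].
Qed.

(** For a [PCoind] variable joinability of [C] and [D] suffices, as they land only inside
    coinductive boxes; occurrences outside require that [C] and [D] agree there. *)
Lemma leadsto_subst k G A B C D :
  typ_ind typ G A -> leadsto ijoin A B -> ijoin C D ->
  (G k = Some PCoind \/ G k = None \/ leadsto ijoin C D) ->
  leadsto ijoin (subst k C A) (subst k D B).
Proof.
  intros HA HL HJ; revert k B HL.
  induction HA as [G x H1 H2|G G1 G2 M N HS _ IH1 _ IH2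
    |G M _ IH|G M _ IH|G M _ IH|G M _ IH|G M Hb _ IH|G M Hb HM];
  intros k B HL HK; inversion HL; subst; unf; auto using ijoin_subst.
  - ncase; auto; subst.
    destruct HK as [HK|[HK|HK]]; [rewrite HK in H1; intuition discriminate..|].
    apply leadsto_ijoin_lift, HK.
  - specialize (HS k); constructor; [apply IH1|apply IH2]; auto;
    destruct HK as [HK|[HK|HK]]; auto; rewrite HK in HS; tauto.
  - constructor; apply IH; auto; unfold boxI_env.
    destruct HK as [HK|[HK|HK]]; auto; rewrite HK; auto.
Qed.

Lemma basic_commutes G M M' N :
  typ_ind typ G M -> leadsto ijoin M N -> basic M M' ->
  exists N', basic N N' /\ leadsto ijoin M' N'.
Proof.
  intros HM HL HB.
  destruct HB as [M B P E|M B P E|M B P E];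
  inversion HL as [|? M1 ? B1 L1 L2| | | | |]; subst;
  inversion L1; subst; try (inversion L2; subst);
  (eexists; split; [eauto|]);
  (eapply leadsto_ijoin_bisim; [|apply bisim_sym, E|apply bisim_refl]);
  inversion HM as [|? G1 G2 ? ? HS T1 T2| | | | | |]; subst;
  inversion T1; subst; eapply leadsto_subst; eauto using ijoin_leadsto; cbn; auto.
Qed.

Lemma step0_commutes G M M' N :
  typ_ind typ G M -> leadsto ijoin M N -> step0 M M' ->
  exists N', step0 N N' /\ leadsto ijoin M' N'.
Proof.
  intros HM HL HS; revert G N HM HL; induction HS; intros G L HM HL;
  [destruct (basic_commutes _ _ _ _ HM HL H) as (P & H1 & H2); eauto|..];
  inversion HL; inversion HM; subst; edestruct IHHS as (? & ? & ?); eauto.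
Qed.

Lemma steps0_commutes M M' N :
  wf M -> leadsto ijoin M N -> steps0 M M' ->
  exists N', steps0 N N' /\ leadsto ijoin M' N'.
Proof.
  intros HM HL HS; revert N HM HL; induction HS; intros N' HM HL; [eauto|].
  assert (HN := wf_step _ _ HM (step0_step _ _ H)).
  destruct HM as [G HM]; apply typ_unfold in HM.
  destruct (step0_commutes _ _ _ _ HM HL H) as (N1 & H1 & L1).
  destruct (IHHS _ HN L1) as (N2 & H2 & L2); eauto.
Qed.

Lemma leadsto_ijoin_sym a b : leadsto ijoin a b -> leadsto ijoin b a.
Proof.
  intros H; apply leadsto_sym in H; revert H; apply leadsto_mono.
  intros x y; apply ijoin_sym.
Qed.

Lemma leadsto_nf0 M N :
  wf M -> wf N -> leadsto ijoin M N -> leadsto ijoin (nf0 M) (nf0 N).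
Proof.
  intros HM HN HL; destruct (nf0_spec M HM) as [S1 N1], (nf0_spec N HN) as [S2 N2].
  destruct (steps0_commutes _ _ _ HM HL S1) as (N' & S3 & L).
  apply leadsto_ijoin_bisim with (nf0 M) N'; auto.
  apply (normal0_unique N); auto; intros P HP.
  destruct (wf_steps _ _ HN (steps0_steps _ _ S3)) as [G HG].
  destruct (step0_commutes _ _ _ _ (typ_unfold _ _ HG) (leadsto_ijoin_sym _ _ L) HP)
    as (Q & HQ & _).
  exact (N1 _ HQ).
Qed.

Lemma step_nf0 M N : wf M -> step M N -> leadsto ijoin (nf0 M) (nf0 N).
Proof.
  intros HM HS; assert (HN := wf_step _ _ HM HS).
  assert (H := HM); destruct H as [G HG]; apply typ_unfold in HG.
  destruct (step_cases _ _ _ HG HS) as [H0|HL]; [|auto using leadsto_nf0].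
  apply wf_bisim_leadsto; [auto using wf_nf0|].
  destruct (nf0_spec M HM), (nf0_spec N HN).
  apply (normal0_unique M); eauto.
Qed.

Definition wf_ijoin (M N : pterm) : Prop := wf M /\ wf N /\ ijoin M N.

Inductive conv : pterm -> pterm -> Prop :=
| conv_ijoin M N : wf_ijoin M N -> conv M N
| conv_trans M N L : conv M N -> conv N L -> conv M L.

Lemma leadsto_conv M N :
  wf M -> wf N -> leadsto ijoin M N -> leadsto conv M N.
Proof.
  intros [G HM] [H HN] HL; apply typ_unfold in HM; apply typ_unfold in HN.
  revert G H HM HN; induction HL; intros G H' HM HN; inversion HM; inversion HN; subst;
  eauto.
  constructor; apply conv_ijoin; split; [|split]; auto; eexists; eassumption.
Qed.

Lemma steps_nf0 M N : wf M -> steps M N -> leadsto conv (nf0 M) (nf0 N).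
Proof.
  intros HM HS; induction HS as [M|M N L H HS IH].
  - apply leadsto_conv; auto using wf_nf0.
    apply wf_bisim_leadsto; auto using wf_nf0.
  - assert (HN := wf_step _ _ HM H).
    apply leadsto_trans with (nf0 N); [exact conv_trans| |auto].
    apply leadsto_conv; auto using wf_nf0, step_nf0.
Qed.

Lemma conv_sym M N : conv M N -> conv N M.
Proof.
  induction 1 as [M N (H1 & H2 & H3)|]; [|eauto using conv_trans].
  apply conv_ijoin; split; [|split]; auto using ijoin_sym.
Qed.

Lemma conv_nf0 M N : conv M N -> leadsto conv (nf0 M) (nf0 N).
Proof.
  induction 1 as [M N (HM & HN & HJ)|M N L _ IH1 _ IH2];
  [|eapply leadsto_trans; eauto using conv_trans].
  apply ijoin_unfold in HJ as (M' & N' & SM & SN & L).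
  apply leadsto_trans with (nf0 M'); [exact conv_trans|auto using steps_nf0|].
  apply leadsto_trans with (nf0 N'); [exact conv_trans| |].
  - apply leadsto_conv; [..|apply leadsto_nf0]; eauto using wf_nf0, wf_steps.
  - assert (H := leadsto_sym _ _ _ (steps_nf0 _ _ HN SN)).
    revert H; apply leadsto_mono; intros x y; apply conv_sym.
Qed.

CoFixpoint gen (t : pterm) : pterm :=
  match t with
  | Var n => Var n
  | App a b => App (gen a) (gen b)
  | Lam a => Lam (gen a)
  | LamI a => LamI (gen a)
  | LamC a => LamC (gen a)
  | BoxI a => BoxI (gen a)
  | BoxC a => BoxC (gen (nf0 a))
  end.

Definition nf (M : pterm) : pterm := gen (nf0 M).

Lemma gen_var n : gen (Var n) = Var n.
Proof. unfold_cofix. Qed.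
Lemma gen_app a b : gen (App a b) = App (gen a) (gen b).
Proof. unfold_cofix. Qed.
Lemma gen_lam a : gen (Lam a) = Lam (gen a).
Proof. unfold_cofix. Qed.
Lemma gen_lamI a : gen (LamI a) = LamI (gen a).
Proof. unfold_cofix. Qed.
Lemma gen_lamC a : gen (LamC a) = LamC (gen a).
Proof. unfold_cofix. Qed.
Lemma gen_boxI a : gen (BoxI a) = BoxI (gen a).
Proof. unfold_cofix. Qed.
Lemma gen_boxC a : gen (BoxC a) = BoxC (nf a).
Proof. unfold_cofix. Qed.

Hint Rewrite gen_var gen_app gen_lam gen_lamI gen_lamC gen_boxI gen_boxC : unf.

Lemma conv_nf M N : conv M N -> bisim (nf M) (nf N).
Proof.
  intros H; apply (bisim_coind (fun x y =>
    exists a b, leadsto conv a b /\ x = gen a /\ y = gen b));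
  [|exists (nf0 M), (nf0 N); auto using conv_nf0].
  clear; intros x y (a & b & H & -> & ->); left.
  destruct H; unf; constructor; eauto 6.
  unfold nf; eauto 7 using conv_nf0.
Qed.

Lemma infred_nf M P : wf M -> bisim (nf M) P -> infred M P.
Proof.
  intros HM E; exists (fun a b => wf a /\ bisim (nf a) b); split; [|auto].
  clear; intros a b [Ha E]; exists (nf0 a); split.
  - apply steps0_steps, nf0_spec, Ha.
  - destruct (wf_nf0 a Ha) as [G H]; apply typ_unfold in H.
    unfold nf in E; revert b E; induction H; intros b E; unf;
    inversion E; subst; auto.
    constructor; split; [eexists; eassumption|auto].
Qed.

Theorem mainTheorem16 (M N L : pterm) :
  is_term M -> infred M N -> infred M L ->
  exists P, is_term P /\ infred N P /\ infred L P.
Proof.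
  intros (G & [m Hm] & HG) HN HL.
  assert (HM : wf M) by (exists G; auto).
  assert (K : forall N, infred M N -> infred N (nf M)).
  { intros N' H; destruct (typ_infred _ _ _ HG H) as (G' & _ & H').
    assert (W : wf N') by (exists G'; auto).
    apply infred_nf; auto; apply conv_nf, conv_sym, conv_ijoin.
    split; [|split]; auto using infred_ijoin. }
  exists (nf M); split; [|auto].
  destruct (typ_infred _ _ _ HG (infred_nf M (nf M) HM (bisim_refl _)))
    as (G' & HL' & H').
  exists G'; split; [|exact H']; exists m; intros i Hi.
  destruct (HL' i) as [->|[E _]]; [auto|]; rewrite Hm in E; [discriminate|auto].
Qed.
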